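(* Let $S$ be a topological space endowed with a strictly positive measure $\upsilon$, and let $(X_s)_{s\in S}$ be a complex-valued centred stochastic process on a complete probability space $(\Omega,\mathcal{F},\mathbb{P})$ with continuous covariance function and such that $$\int_S\mathbb{E}(|X_s|^2)\,d\upsilon(s)<+\infty .$$ Then the kernel $K(t,s)=\mathbb{E}(X_t\overline{X_s})$ associated with the covariance function of $X$ is a Mercer's kernel. Therefore, $X$ admits a Karhunen–Loève expansion $$X=\sum_{j=1}^{+\infty}\lambda_j\zeta_j,$$ where $\{\zeta_j\}_{j\in\mathbb{N}}$ is an orthonormal basis of $L^2(S,\upsilon)$, $$\lambda_j=\int_SX_s\,\overline{\zeta_j(s)}\,d\upsilon(s),$$ with $\mathbb{E}[\lambda_j]=0$, and there exists a sequence $\{a_j\}_{j\in\mathbb{N}}$ of non-negative real numbers such that $\mathbb{E}[\lambda_j\overline{\lambda_k}]=\delta_{jk}\,a_j$ and $\mathrm{Var}[\lambda_j]=a_j$. The series expansion converges in $L^2(\Omega\times S;\mathbb{C})$, i.e. $$\lim_{J\to+\infty}\mathbb{E}\Big(\int_S\Big|X_s-\sum_{j=1}^J\lambda_j\zeta_j(s)\Big|^2d\upsilon(s)\Big)=0 .$$ The series expansion converges in $L^2(\Omega;\mathbb{C})$ for all $s\in S$, i.e. for all $s\in S$ $$\lim_{J\to+\infty}\mathbb{E}\Big(\Big|X_s-\sum_{j=1}^J\lambda_j\zeta_j(s)\Big|^2\Big)=0 .$$ The convergence of the series expansion is absolute and uniform on compact subsets of $S$ in the mean-square sense.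
   Context: A strictly positive measure $\upsilon$ on a topological space $S$ is a complete Borel measure on $S$ such that every open nonempty subset of $S$ has positive measure and every $x\in S$ belongs to an open subset of $S$ having finite measure. Centred means $\mathbb{E}[X_s]=0$ for all $s\in S$. A continuous kernel $K:S\times S\to\mathbb{C}$ is a Mercer's kernel when it possesses a series representation $K(x,y)=\sum_{j=1}^\infty a_j(\mathcal{K})\,\zeta_j(x)\overline{\zeta_j(y)}$, $x,y\in S$, where $\{\zeta_j\}_{j\in\mathbb{N}}$ is an $L^2(S,\upsilon)$-orthonormal basis of continuous functions on $S$, $\{a_j(\mathcal{K})\}_{j\in\mathbb{N}}$ decreases to $0$, and the series converges uniformly and absolutely on compact subsets of $S\times S$. Here $\mathcal{K}$ is the integral operator $\mathcal{K}(f)(x)=\int_SK(x,y)f(y)\,d\upsilon(y)$ on $L^2(S,\upsilon)$. $\delta_{jk}$ is the Kronecker delta.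
   Formalization: X is assumed jointly measurable and υ σ-finite; {ζ_j} is a basis only if L²(S,υ) has one indexed by ℕ (otherwise orthonormal where a_j≠0); ζ_j is continuous only where a_j≠0, and a_k≤a_j for k≥j is asserted only where a_j≠0; unrestricted, the claim is false. *)

(* Defs.v *)
From HB Require Import structures.
From mathcomp Require Import all_boot all_order all_algebra.
From mathcomp Require Import complex.
From mathcomp Require Import all_classical all_reals all_analysis.
Import numFieldNormedType.Exports.

Set Implicit Arguments.
Unset Strict Implicit.
Unset Printing Implicit Defensive.

Import Order.TTheory GRing.Theory Num.Theory ComplexField.Normc.
Local Open Scope classical_set_scope.
Local Open Scope ring_scope.
Local Open Scope complex_scope.

(* A topology and a sigma-algebra on the same carrier.  They are unrelated
   here: [strictly_positive_measure] requires the open sets to be measurable. *)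
#[short(type="topMeasurableType")]
HB.structure Definition TopMeasurable d := {T of Topological T & Measurable d T}.

(* "Complete Borel measure": the sigma-algebra contains the open sets, and the
   measure is complete on it. *)
Definition strictly_positive_measure (R : realType) (d : measure_display)
    (S : topMeasurableType d) (mu : {measure set S -> \bar R}) : Prop :=
  [/\ forall U : set S, open U -> measurable U,
      measure_is_complete mu,
      forall U : set S, open U -> U !=set0 -> (0 < mu U)%E
    & forall x : S, exists U : set S, [/\ open U, U x & (mu U < +oo)%E]].

Section complex_integration.
Context (R : realType) (d : measure_display) (T : measurableType d).
Implicit Types (mu : {measure set T -> \bar R}) (f g : T -> R[i]).

Definition cmeasurable f : Prop :=
  measurable_fun setT (fun x => complex.Re (f x)) /\
  measurable_fun setT (fun x => complex.Im (f x)).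

Definition cintegrable mu f : Prop :=
  mu.-integrable setT (EFin \o (fun x => complex.Re (f x))) /\
  mu.-integrable setT (EFin \o (fun x => complex.Im (f x))).

(* Meaningful when [cintegrable mu f]. *)
Definition cintegral mu f : R[i] :=
  (\int[mu]_x complex.Re (f x)) +i* (\int[mu]_x complex.Im (f x)).

Definition sqnorm2 mu f : \bar R := (\int[mu]_x (normc (f x) ^+ 2)%:E)%E.

Definition L2 mu f : Prop := cmeasurable f /\ (sqnorm2 mu f < +oo)%E.

Definition L2dot mu f g : R[i] := cintegral mu (fun x => f x * (g x)^*).

Definition orthonormal_basis mu (z : nat -> T -> R[i]) : Prop :=
  [/\ forall j, L2 mu (z j),
      forall j k, L2dot mu (z j) (z k) = (j == k)%:R
    & forall f, L2 mu f ->
        sqnorm2 mu (fun x => f x - \sum_(j < J) L2dot mu f (z j) * z j x)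
          @[J --> \oo] --> 0%E].

End complex_integration.

Section mercer.
Context (R : realType) (d : measure_display) (S : topMeasurableType d).
Variable mu : {measure set S -> \bar R}.

Definition integral_operator (K : S -> S -> R[i]) (f : S -> R[i]) : S -> R[i] :=
  fun x => cintegral mu (fun y => K x y * f y).

(* K = sum_j a_j z_j(x) conj(z_j(y)) with a_j -> 0 in decreasing order, where
   (z_j) is an orthonormal basis of L^2 indexed by nat as soon as L^2 has one
   (it has none when it is finite-dimensional or nonseparable; then the z_j with
   a_j = 0 merely pad the sequence).
   The null space of the integral operator need not contain any nonzero
   continuous function, and an enumeration by nat of infinitely many positive
   eigenvalues in decreasing order leaves no room for the eigenvalue 0.  As the
   z_j are to span all of L^2, continuity of z_j is therefore required only when
   a_j is nonzero (other terms contribute nothing to the series), and the order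
   is that of the nonzero a_j.  If the operator is injective and (z_j) is a
   basis, then every z_j is continuous and a is nonincreasing. *)
Definition mercer_expansion (K : S -> S -> R[i])
    (z : nat -> S -> R[i]) (a : nat -> R) : Prop :=
  [/\ continuous ((fun p : S * S => K p.1 p.2) : S * S -> R[i]^o),
      [/\ forall j, L2 mu (z j),
          forall j k, a j != 0 -> a k != 0 ->
            L2dot mu (z j) (z k) = (j == k)%:R,
          (exists e : nat -> S -> R[i], orthonormal_basis mu e) ->
            orthonormal_basis mu z
        & forall j, a j != 0 -> continuous (z j : S -> R[i]^o)],
      [/\ forall j, 0 <= a j,
          forall j k, (j <= k)%N -> a j != 0 -> a k <= a j
        & a j @[j --> \oo] --> (0 : R)],
      forall j x, integral_operator K (z j) x = (a j)%:C * z j x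
    & forall C : set (S * S), compact C -> forall e : R, 0 < e ->
        \forall J \near \oo, forall x y, C (x, y) ->
          normc (K x y - \sum_(j < J) (a j)%:C * z j x * (z j y)^*) < e /\
          (\sum_(J <= j <oo) (normc ((a j)%:C * z j x * (z j y)^*))%:E
             < e%:E)%E].

End mercer.

Section process.
Context (R : realType) (d d' : measure_display) (Omega : measurableType d)
  (S : topMeasurableType d').
Variables (P : probability Omega R) (X : S -> Omega -> R[i]).

Definition cexpectation (Y : Omega -> R[i]) : R[i] := cintegral P Y.

Definition cvariance (Y : Omega -> R[i]) : \bar R :=
  sqnorm2 P (fun w => Y w - cexpectation Y).

Definition covariance_function (t s : S) : R[i] :=
  cexpectation (fun w => (X t w - cexpectation (X t)) *
                         (X s w - cexpectation (X s))^*).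

Definition covariance_kernel (t s : S) : R[i] :=
  cexpectation (fun w => X t w * (X s w)^*).

Definition KL_coef (mu : {measure set S -> \bar R}) (z : nat -> S -> R[i])
    (j : nat) (w : Omega) : R[i] :=
  cintegral mu (fun s => X s w * (z j s)^*).

Definition KL_remainder (mu : {measure set S -> \bar R})
    (z : nat -> S -> R[i]) (J : nat) (s : S) (w : Omega) : R[i] :=
  X s w - \sum_(j < J) KL_coef mu z j w * z j s.

End process.

(* Main.v *)
(** The covariance kernel K is the Gram kernel of the vectors X_x of L^2(P), so
    the operator T with kernel K satisfies |T g(x)|^2 <= K(x, x) <T g, g>.  Let M
    be the supremum of <T u, u> on the unit ball and U = T / M.  Being decreasing
    moments of a positive contraction, the numbers <U^n u, u> converge, and hence
    so does U^n u, to a fixed vector of U.  The limit is nonzero for some section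
    u = K(., y): otherwise U^n K(., y) -> 0 for all y and, by dominated
    convergence, U^(n+1) u_n -> 0 for nearly maximizing unit vectors u_n,
    although ||U^(n+1) u_n|| is bounded below.  This produces a top eigenpair
    (a, z) without any compactness argument.  Replacing X by X - lambda z, where
    lambda is the coefficient of X along z, deflates K to K - a z z^*, and
    iterating gives decreasing eigenvalues with sum at most the integral of
    K(x, x).  The diagonals K_J(x, x) of the deflated kernels, which are the
    mean-square errors of the expansion, decrease; the inequality
    \int |K_J(y, x)|^2 dy <= a_J K_J(x, x) and the positivity of the measure of
    open sets force their limit to be 0, and Dini's argument makes the
    convergence uniform on compact sets.  If L^2 has a basis indexed by nat, an
    orthonormal basis of the null space of T is interleaved with the
    eigenfunctions. *)

Require Import Defs.
From HB Require Import structures.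
From mathcomp Require Import all_boot all_order all_algebra.
From mathcomp Require Import complex.
From mathcomp Require Import all_classical all_reals all_analysis.
From mathcomp Require Import measurable_realfun ring lra.
Import numFieldNormedType.Exports.

Set Implicit Arguments.
Unset Strict Implicit.
Unset Printing Implicit Defensive.

Import Order.TTheory GRing.Theory Num.Theory.
Local Open Scope classical_set_scope.
Local Open Scope ring_scope.
Local Open Scope complex_scope.

Local Notation normc := ComplexField.Normc.normc.

(** The expansion has to hold at every point, so vectors of L^2 are genuine functions throughout and
    scalar products are only semidefinite. This is workable because the value of T g at x is the
    scalar product of g with K(., x): null vectors are sent to the function 0, and an identity valid
    up to a null vector becomes pointwise after one more application of T. Symmetry and positivity
    of T come from its factorization through L^2(P) by the map g -> [coef mu X g], so a deflated
    kernel inherits them as the kernel of a process. Compactness is replaced by an integrable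
    majorant: on the unit ball |T g(x)|^2 is at most a constant times K(x, x). When a deflated
    operator has vanishing form, the zero vector is returned with eigenvalue 0; orthonormal families
    therefore carry null entries, which are deleted only when a basis indexed by nat has to be
    produced. *)

Section complex_facts.
Context {R : realType}.
Implicit Types x y z : R[i].

Lemma cReD x y : complex.Re (x + y) = complex.Re x + complex.Re y.
Proof. by case: x y => [a b] [c e]. Qed.

Lemma cImD x y : complex.Im (x + y) = complex.Im x + complex.Im y.
Proof. by case: x y => [a b] [c e]. Qed.

Lemma cReN x : complex.Re (- x) = - complex.Re x.
Proof. by case: x. Qed.

Lemma cImN x : complex.Im (- x) = - complex.Im x.
Proof. by case: x. Qed.

Lemma cReM x y :
  complex.Re (x * y) = complex.Re x * complex.Re y - complex.Im x * complex.Im y.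
Proof. by case: x y => [a b] [c e]. Qed.

Lemma cImM x y :
  complex.Im (x * y) = complex.Re x * complex.Im y + complex.Im x * complex.Re y.
Proof. by case: x y => [a b] [c e]. Qed.

Lemma Re_conjc x : complex.Re x^* = complex.Re x.
Proof. by case: x. Qed.

Lemma Im_conjc x : complex.Im x^* = - complex.Im x.
Proof. by case: x. Qed.

Lemma complex_ext x y :
  complex.Re x = complex.Re y -> complex.Im x = complex.Im y -> x = y.
Proof. by case: x y => [a b] [c e] /= -> ->. Qed.

Lemma ReRM (a : R) x : complex.Re (a%:C * x) = a * complex.Re x.
Proof. by rewrite cReM /= mul0r subr0. Qed.

Lemma ImRM (a : R) x : complex.Im (a%:C * x) = a * complex.Im x.
Proof. by rewrite cImM /= mul0r addr0. Qed.

Lemma normc_sqr x : normc x ^+ 2 = complex.Re x ^+ 2 + complex.Im x ^+ 2.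
Proof. by case: x => a b /=; rewrite sqr_sqrtr// addr_ge0// sqr_ge0. Qed.

Lemma normc_ge0 x : 0 <= normc x.
Proof. by case: x => a b; rewrite sqrtr_ge0. Qed.

Lemma mulc_conjc x : x * x^* = (normc x ^+ 2)%:C.
Proof.
apply: complex_ext; rewrite ?cReM ?cImM Re_conjc Im_conjc.
  by rewrite normc_sqr /=; ring.
by rewrite /=; ring.
Qed.

Lemma normc_conjc x : normc x^* = normc x.
Proof. by case: x => a b /=; rewrite sqrrN. Qed.

Lemma normc_real (a : R) : 0 <= a -> normc a%:C = a.
Proof. by move=> a0 /=; rewrite expr0n /= addr0 sqrtr_sqr ger0_norm. Qed.

Lemma normrE_normc x : `|x| = (normc x)%:C.
Proof. by rewrite normc_def; case: x. Qed.

Lemma normr_Re_le x : `|complex.Re x| <= normc x.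
Proof.
rewrite -(@ler_pXn2r _ 2)// ?nnegrE ?normr_ge0 ?normc_ge0//.
by rewrite normc_sqr real_normK ?num_real// lerDl sqr_ge0.
Qed.

Lemma normr_Im_le x : `|complex.Im x| <= normc x.
Proof.
rewrite -(@ler_pXn2r _ 2)// ?nnegrE ?normr_ge0 ?normc_ge0//.
by rewrite normc_sqr real_normK ?num_real// lerDr sqr_ge0.
Qed.

Lemma Re_le_normc x : complex.Re x <= normc x.
Proof. exact: le_trans (ler_norm _) (normr_Re_le x). Qed.

Lemma normc_le_ReIm x : normc x <= `|complex.Re x| + `|complex.Im x|.
Proof.
rewrite -(@ler_pXn2r _ 2)// ?nnegrE ?normc_ge0 ?addr_ge0//.
rewrite normc_sqr sqrrD !real_normK ?num_real// addrAC lerDl.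
by rewrite mulrn_wge0// mulr_ge0.
Qed.

Lemma normcD_le x y : normc (x + y) <= normc x + normc y.
Proof. exact: le_normcD. Qed.

Lemma normcB_sym x y : normc (x - y) = normc (y - x).
Proof. by rewrite -normcN opprB. Qed.

Lemma normcD_sqr x y :
  normc (x + y) ^+ 2 <= 2 * normc x ^+ 2 + 2 * normc y ^+ 2.
Proof.
rewrite !normc_sqr cReD cImD.
have h1 := sqr_ge0 (complex.Re x - complex.Re y).
have h2 := sqr_ge0 (complex.Im x - complex.Im y).
by nra.
Qed.

Lemma Re_sum I (r : seq I) (Q : pred I) (F : I -> R[i]) :
  complex.Re (\sum_(i <- r | Q i) F i) = \sum_(i <- r | Q i) complex.Re (F i).
Proof. by elim/big_rec2: _ => //= i u v _ <-; rewrite cReD. Qed.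

(** Testing multiples c = t z is enough. For B != 0, t = 1/B gives the bound; for B = 0 the
    expression is affine in t, and a large t excludes z != 0. *)
Lemma discriminant_le (A B : R) z : 0 <= B ->
  (forall c : R[i],
    0 <= A + normc c ^+ 2 * B - 2 * complex.Re (c^* * z)) ->
  normc z ^+ 2 <= A * B.
Proof.
move=> B0 h; rewrite normc_sqr.
have hr t : 0 <= A + t ^+ 2 * (complex.Re z ^+ 2 + complex.Im z ^+ 2) * B
   - 2 * t * (complex.Re z ^+ 2 + complex.Im z ^+ 2).
  have := h (t%:C * z).
  rewrite normc_sqr [complex.Re (_^* * _)]cReM Re_conjc Im_conjc !ReRM !ImRM.
  by apply: etrans; congr (_ <= _); ring.
have := addr_ge0 (sqr_ge0 (complex.Re z)) (sqr_ge0 (complex.Im z)).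
move: hr; set q := _ + _ => hr q0.
have [B00|Bn0] := eqVneq B 0.
  rewrite B00 mulr0.
  have := hr ((A + 1) / (2 * q)).
  have [->//|qn0] := eqVneq q 0.
  rewrite B00 mulr0 addr0.
  have -> : 2 * ((A + 1) / (2 * q)) * q = A + 1 by field.
  by lra.
have := hr B^-1.
have -> : A + B^-1 ^+ 2 * q * B - 2 * B^-1 * q = (A * B - q) / B by field.
by rewrite pmulr_lge0 ?invr_gt0 ?lt_def ?Bn0// subr_ge0.
Qed.

End complex_facts.

(** * Semi-inner products *)

(* The form is only semidefinite, so that functions equal almost everywhere
   need not be identified. *)
Record semi_inner (R : realType) (V : lmodType R[i]) (dot : V -> V -> R[i]) :
    Prop := SemiInner {
  semi_innerD : forall u v w, dot (u + v) w = dot u w + dot v w;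
  semi_innerZ : forall a u v, dot (a *: u) v = a * dot u v;
  semi_innerC : forall u v, dot v u = (dot u v)^*;
  semi_inner_ge0 : forall u, 0 <= complex.Re (dot u u) }.

Section semi_inner_theory.
Context {R : realType} {V : lmodType R[i]} (dot : V -> V -> R[i]).
Hypothesis dotP : semi_inner dot.
Implicit Types (u v : V) (a : R[i]).

Definition sqn u : R := complex.Re (dot u u).

Let dotDl : forall u v w, dot (u + v) w = dot u w + dot v w.
Proof. exact: semi_innerD dotP. Qed.
Let dotZl : forall a u v, dot (a *: u) v = a * dot u v.
Proof. exact: semi_innerZ dotP. Qed.
Let dotC : forall u v, dot v u = (dot u v)^*.
Proof. exact: semi_innerC dotP. Qed.

Lemma sqn_ge0 u : 0 <= sqn u.
Proof. exact: semi_inner_ge0 dotP u. Qed.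

Lemma dotDr u v w : dot u (v + w) = dot u v + dot u w.
Proof. by rewrite dotC dotDl rmorphD /= -!dotC. Qed.

Lemma dotZr a u v : dot u (a *: v) = a^* * dot u v.
Proof. by rewrite dotC dotZl rmorphM /= -dotC. Qed.

Lemma dotNl u v : dot (- u) v = - dot u v.
Proof. by rewrite -scaleN1r dotZl mulN1r. Qed.

Lemma dotNr u v : dot u (- v) = - dot u v.
Proof. by rewrite dotC dotNl rmorphN /= -dotC. Qed.

Lemma dotBl u v w : dot (u - v) w = dot u w - dot v w.
Proof. by rewrite dotDl dotNl. Qed.

Lemma dotBr u v w : dot u (v - w) = dot u v - dot u w.
Proof. by rewrite dotDr dotNr. Qed.

Lemma dot0l u : dot 0 u = 0.
Proof. by rewrite -(scale0r 0) dotZl mul0r. Qed.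

Lemma dot0r u : dot u 0 = 0.
Proof. by rewrite dotC dot0l conjc0. Qed.

Lemma dot_suml I (r : seq I) (Q : pred I) (F : I -> V) v :
  dot (\sum_(i <- r | Q i) F i) v = \sum_(i <- r | Q i) dot (F i) v.
Proof. by elim/big_rec2: _ => [|i x y _ <-]; rewrite ?dot0l ?dotDl. Qed.

Lemma dot_sumr I (r : seq I) (Q : pred I) (F : I -> V) v :
  dot v (\sum_(i <- r | Q i) F i) = \sum_(i <- r | Q i) dot v (F i).
Proof. by elim/big_rec2: _ => [|i x y _ <-]; rewrite ?dot0r ?dotDr. Qed.

Lemma dotvv u : dot u u = (sqn u)%:C.
Proof.
apply: complex_ext => //=.
have := congr1 (@complex.Im R) (dotC u u); rewrite Im_conjc => h.
by lra.
Qed.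

Lemma sqn0 : sqn 0 = 0.
Proof. by rewrite /sqn dot0l. Qed.

Lemma sqnD u v : sqn (u + v) = sqn u + sqn v + 2 * complex.Re (dot u v).
Proof.
rewrite /sqn dotDl !dotDr !cReD [in complex.Re (dot v u)]dotC Re_conjc; ring.
Qed.

Lemma sqnZ a u : sqn (a *: u) = normc a ^+ 2 * sqn u.
Proof. by rewrite /sqn dotZl dotZr mulrA mulc_conjc ReRM. Qed.

Lemma sqnN u : sqn (- u) = sqn u.
Proof. by rewrite /sqn dotNl dotNr opprK. Qed.

Lemma sqnB u v : sqn (u - v) = sqn u + sqn v - 2 * complex.Re (dot u v).
Proof. by rewrite sqnD sqnN dotNr cReN mulrN. Qed.

Lemma sqnBC u v : sqn (u - v) = sqn (v - u).
Proof. by rewrite -sqnN opprB. Qed.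

Lemma sqnD_le u v : sqn (u + v) <= 2 * sqn u + 2 * sqn v.
Proof. by have := sqn_ge0 (u - v); rewrite sqnB sqnD; lra. Qed.

Lemma Cauchy_Schwarz u v : normc (dot u v) ^+ 2 <= sqn u * sqn v.
Proof.
apply: discriminant_le; first exact: sqn_ge0.
move=> c; have := sqn_ge0 (u - c *: v).
by rewrite sqnB sqnZ dotZr.
Qed.

(** Cauchy-Schwarz makes null vectors orthogonal to everything, so they can be carried along without
    passing to a quotient. *)
Lemma dot_null u v : sqn v = 0 -> dot u v = 0.
Proof.
move=> v0; apply: ComplexField.Normc.eq0_normc; apply/eqP.
have := Cauchy_Schwarz u v; rewrite v0 mulr0 => h.
by rewrite -sqrf_eq0 eq_le h sqr_ge0.
Qed.

Lemma dot_null_l u v : sqn u = 0 -> dot u v = 0.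
Proof. by move=> u0; rewrite dotC dot_null// conjc0. Qed.

(* [nz] allows a finite orthonormal family to be padded with null vectors. *)
Definition orthonormal_on (nz : pred nat) (w : nat -> V) :=
  forall j k, dot (w j) (w k) = ((j == k) && nz j)%:R.

Definition psum (w : nat -> V) (c : nat -> R[i]) (J : nat) : V :=
  \sum_(j < J) c j *: w j.

Definition complete_family (w : nat -> V) :=
  forall f e, 0 < e -> exists J c, sqn (f - psum w c J) < e.

Section bessel.
Context (nz : pred nat) (w : nat -> V).
Hypothesis ow : orthonormal_on nz w.

Local Notation S f J := (psum w (fun j => dot f (w j)) J).

Lemma orthonormal_on_null k : ~~ nz k -> sqn (w k) = 0.
Proof. by move=> /negPf k0; rewrite /sqn ow k0 andbF. Qed.

Lemma dot_psum c J k :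
  dot (psum w c J) (w k) = ((k < J)%N && nz k)%:R * c k.
Proof.
rewrite dot_suml; have [kJ|kJ] := ltnP k J; last first.
  rewrite mul0r big1// => i _; rewrite dotZl ow; case: eqP => [ik|_] /=; last by rewrite mulr0.
  by move: (ltn_ord i); rewrite ik ltnNge kJ.
rewrite (bigD1 (Ordinal kJ))//= big1 ?addr0; last first.
  move=> i ik; rewrite dotZl ow.
  have -> : (i == k :> nat) = false by apply: contraNF ik => /eqP ik; apply/eqP/val_inj.
  by rewrite mulr0.
by rewrite dotZl ow eqxx mulrC.
Qed.

Lemma dot_residual f J k : (k < J)%N -> dot (f - S f J) (w k) = 0.
Proof.
move=> kJ; rewrite dotBl dot_psum kJ/=.
by case: (boolP (nz k)) => [|/orthonormal_on_null k0]; rewrite ?mul1r ?subrr ?dot_null// mul0r subr0.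
Qed.

Lemma dot_residual_psum f c J : dot (f - S f J) (psum w c J) = 0.
Proof. by rewrite dot_sumr big1// => i _; rewrite dotZr dot_residual// mulr0. Qed.

Lemma psumB c c' J : psum w c J - psum w c' J = psum w (fun j => c j - c' j) J.
Proof. by rewrite -sumrB; apply: eq_bigr => i _; rewrite scalerBl. Qed.

(** The residual is orthogonal to the span, so any other choice of coefficients only adds a squared
    norm. *)
Lemma best_approximation f c J : sqn (f - S f J) <= sqn (f - psum w c J).
Proof.
have -> : f - psum w c J = (f - S f J) + (S f J - psum w c J).
  by rewrite addrA subrK.
rewrite [leRHS]sqnD psumB dot_residual_psum mulr0 addr0 lerDl; exact: sqn_ge0.
Qed.

Lemma psum_pad c J K : (J <= K)%N ->
  psum w (fun j => if (j < J)%N then c j else 0) K = psum w c J.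
Proof.
move=> JK; rewrite /psum (big_ord_widen _ (fun j => c j *: w j) JK).
rewrite [RHS]big_mkcond/=.
by apply: eq_bigr => i _; case: ifP => //; rewrite scale0r.
Qed.

Lemma total_cvg f : complete_family w -> sqn (f - S f J) @[J --> \oo] --> 0.
Proof.
move=> tw; apply/cvgrPdist_lt => e e0.
have [J [c hJ]] := tw f e e0.
near=> K; rewrite sub0r normrN ger0_norm ?sqn_ge0//.
apply: le_lt_trans hJ.
rewrite -(@psum_pad c J K); first exact: best_approximation.
by near: K; exists J.
Unshelve. all: by end_near. Qed.

Lemma sqn_residual f J :
  sqn (f - S f J) = sqn f - \sum_(j < J) normc (dot f (w j)) ^+ 2.
Proof.
have h : dot (S f J) f = (\sum_(j < J) normc (dot f (w j)) ^+ 2)%:C.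
  rewrite dot_suml rmorph_sum/=; apply: eq_bigr => i _.
  by rewrite dotZl [dot (w i) f]dotC mulc_conjc.
have h1 : sqn (S f J) = \sum_(j < J) normc (dot f (w j)) ^+ 2.
  have := dot_residual_psum f (fun j => dot f (w j)) J.
  rewrite dotBl => /eqP; rewrite subr_eq0 => /eqP h2.
  by rewrite /sqn -h2 dotC h Re_conjc.
by rewrite sqnB h1 dotC h conjc_real/=; ring.
Qed.

Lemma bessel f J : \sum_(j < J) normc (dot f (w j)) ^+ 2 <= sqn f.
Proof. by have := sqn_ge0 (f - S f J); rewrite sqn_residual subr_ge0. Qed.

End bessel.

(** Null vectors go to 0, so that the squared norm is exactly 0 or 1, as [orthonormal_on]
    requires. *)
Definition normalize v : V :=
  if sqn v == 0 then 0 else ((Num.sqrt (sqn v))^-1)%:C *: v.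

Lemma sqn_normalize v : sqn (normalize v) = (sqn v != 0)%:R.
Proof.
rewrite /normalize; case: eqP => [_|/eqP v0] /=; first exact: sqn0.
rewrite sqnZ normc_real ?invr_ge0 ?sqrtr_ge0// exprVn sqr_sqrtr ?sqn_ge0//.
by rewrite mulVf.
Qed.

Lemma normalizeK v : sqn (v - (Num.sqrt (sqn v))%:C *: normalize v) = 0.
Proof.
rewrite /normalize; case: eqP => [v0|/eqP v0] /=; first by rewrite scaler0 subr0.
rewrite scalerA -rmorphM /= divff ?scale1r ?subrr ?sqn0//.
by rewrite sqrtr_eq0 -ltNge lt_def v0 sqn_ge0.
Qed.

Lemma dot_normalize0 u v : dot u v = 0 -> dot u (normalize v) = 0.
Proof.
by move=> uv0; rewrite /normalize; case: ifP => _; rewrite ?dot0r// dotZr uv0 mulr0.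
Qed.

(** A vector dependent on its predecessors yields a null [psi k], recorded by [nz], instead of being
    skipped. [Q] transfers a linear condition to the new family; it will be orthogonality to the
    eigenfunctions. *)
Lemma Gram_Schmidt (Q : V -> Prop) (r : nat -> V) :
    (forall i, Q (r i)) ->
    (forall a u v, Q u -> Q v -> Q (a *: u + v)) ->
  exists nz psi, [/\ orthonormal_on nz psi, forall k, Q (psi k)
    & forall k, exists J c, sqn (r k - psum psi c J) = 0].
Proof.
move=> Qr QD.
have Q0 : Q 0 by rewrite -(addNr (r 0)) -scaleN1r; exact: QD.
have QZ a u : Q u -> Q (a *: u) by move=> qu; rewrite -[_ *: _]addr0; exact: QD.
pose next (g : nat -> V) k :=
  normalize (r k - psum g (fun j => dot (r k) (g j)) k).
(* [G k] stores the first k vectors and 0 elsewhere; a whole table is passed on because each new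
   vector depends on all the earlier ones. *)
pose G := fix G k : nat -> V :=
  if k is k'.+1 then fun j => if j == k' then next (G k') k' else G k' j
  else fun=> 0.
pose psi k := G k.+1 k.
have GE k j : (j < k)%N -> G k j = psi j.
  elim: k => // k IH; rewrite ltnS leq_eqVlt => /predU1P[->//|jk] /=.
  by rewrite (ltn_eqF jk) IH.
have G0 k j : (k <= j)%N -> G k j = 0.
  elim: k => // k IH kj /=.
  by rewrite (gtn_eqF kj) IH// ltnW.
pose nz k := sqn (psi k) != 0.
have psiE k : psi k = next (G k) k by rewrite /psi /= eqxx.
have oG k : orthonormal_on (fun j => (j < k)%N && nz j) (G k).
  elim: k => [|k IH] i j; first by rewrite /= dot0l andbF.
  have orth p : (p < k)%N -> dot (psi k) (psi p) = 0.
    move=> pk; rewrite dotC [psi k]psiE dot_normalize0 ?conjc0//.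
    by rewrite dotC -(GE _ _ pk) (dot_residual IH)// conjc0.
  have [ik|ik] := leqP k.+1 i.
    by rewrite G0// dot0l /= andbF.
  have [jk|jk] := leqP k.+1 j.
    rewrite [G _ j]G0// dot0r; case: eqP => // ij.
    by move: ik; rewrite ij ltnS leqNgt jk.
  rewrite !GE//; move: ik jk; rewrite !ltnS => ik jk.
  have [ij|ij] /= := eqVneq i j.
    subst j; rewrite dotvv psiE sqn_normalize.
    rewrite /nz psiE sqn_normalize.
    by case: eqP => _; rewrite ?eqxx ?oner_eq0.
  move: ik jk; rewrite leq_eqVlt => /predU1P[ik|ik]; rewrite leq_eqVlt => /predU1P[jk|jk].
  - by move: ij; rewrite ik jk eqxx.
  - by rewrite ik orth.
  - by rewrite jk dotC orth// conjc0.
  - by rewrite -!(GE k)// IH (negPf ij).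
have opsi : orthonormal_on nz psi.
  move=> i j; have := oG (maxn i j).+1 i j.
  by rewrite !GE ?ltnS ?leq_maxl ?leq_maxr.
have Qpsum g c J : (forall k, Q (g k)) -> Q (psum g c J).
  move=> qg; rewrite /psum; elim/big_rec: _ => // i x _ qx; exact: QD.
have Qnext g k : (forall j, Q (g j)) -> Q (next g k).
  move=> qg; rewrite /next /normalize; case: ifP => // _; apply: QZ.
  by rewrite addrC -scaleN1r; apply: QD; [exact: Qpsum|exact: Qr].
have QG k j : Q (G k j).
  by elim: k j => // k IH j /=; case: eqP => // _; exact: Qnext.
exists nz, psi; split=> [//|k|k]; first exact: QG.
pose v := r k - psum (G k) (fun j => dot (r k) (G k j)) k.
(* The coefficient at index k undoes the normalization. *)
exists k.+1, (fun j => if (j < k)%N then dot (r k) (psi j) else (Num.sqrt (sqn v))%:C).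
rewrite /psum big_ord_recr /= ltnn opprD addrA.
have -> : \sum_(i < k) (if (i < k)%N then dot (r k) (psi i)
    else (Num.sqrt (sqn v))%:C) *: psi i = psum (G k) (fun j => dot (r k) (G k j)) k.
  by apply: eq_bigr => i _; rewrite ltn_ord GE.
by rewrite psiE; exact: normalizeK.
Qed.

(* Bessel's inequality counts the vectors. *)
Lemma finite_not_total nz (w : nat -> V) (e : nat -> V) N :
    orthonormal_on nz w -> (forall k, (N <= k)%N -> ~~ nz k) ->
    orthonormal_on xpredT e ->
  (forall i, exists J c, sqn (e i - psum w c J) < 2^-1) -> False.
Proof.
move=> ow nzN oe h.
have e1 i : sqn (e i) = 1 by rewrite /sqn oe eqxx.
have he i : 2^-1 < \sum_(j < N) normc (dot (e i) (w j)) ^+ 2.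
  have [J [c hJ]] := h i.
  have := le_lt_trans (best_approximation ow (e i) c J) hJ.
  rewrite (sqn_residual ow) e1 => hh.
  have : 2^-1 < \sum_(j < J) normc (dot (e i) (w j)) ^+ 2 by lra.
  move=> /lt_le_trans; apply.
  have hJN : (J <= maxn J N)%N by exact: leq_maxl.
  have hNJ : (N <= maxn J N)%N by exact: leq_maxr.
  rewrite (big_ord_widen _ (fun j => normc (dot (e i) (w j)) ^+ 2) hJN).
  rewrite (big_ord_widen _ (fun j => normc (dot (e i) (w j)) ^+ 2) hNJ).
  rewrite big_mkcond [leRHS]big_mkcond; apply: ler_sum => j _.
  case: ifP => _; case: ifP => // jN; rewrite ?sqr_ge0//.
  have jN' : (N <= j)%N by rewrite leqNgt jN.
  by rewrite dot_null ?(orthonormal_on_null ow)// ?nzN// ComplexField.Normc.normc0 expr0n.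
have hw j : \sum_(i < (2 * N).+1) normc (dot (e i) (w j)) ^+ 2 <= 1.
  have -> : \sum_(i < (2 * N).+1) normc (dot (e i) (w j)) ^+ 2 =
    \sum_(i < (2 * N).+1) normc (dot (w j) (e i)) ^+ 2.
    by apply: eq_bigr => i _; rewrite dotC normc_conjc.
  apply: le_trans (bessel oe (w j) _) _.
  by rewrite /sqn ow eqxx; case: (nz j).
(* Double counting: 2N + 1 unit vectors each put more than 1/2 of their mass on the first N vectors
   [w j], each of which receives at most 1. *)
have : \sum_(i < (2 * N).+1) (2^-1 : R) <= \sum_(j < N) 1.
  apply: (@le_trans _ _
    (\sum_(i < (2 * N).+1) \sum_(j < N) normc (dot (e i) (w j)) ^+ 2)).
    by apply: ler_sum => i _; exact/ltW/he.
  by rewrite exchange_big /=; apply: ler_sum => j _.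
rewrite !sumr_const !card_ord -[leLHS]mulr_natr -(natr1 (2 * N)) natrM.
by lra.
Qed.

(** * Powers of a positive contraction *)

Section power.
Context (U : V -> V).
Hypotheses (UB : forall u v, U (u - v) = U u - U v)
  (Usym : forall u v, dot (U u) v = dot u (U v))
  (Upos : forall u, 0 <= complex.Re (dot (U u) u))
  (U1 : forall u, complex.Re (dot (U u) u) <= sqn u)
  (U2 : forall u, sqn (U u) <= complex.Re (dot (U u) u)).

Local Notation c n u := (complex.Re (dot (iter n U u) u)).

Lemma iter_sym n u v : dot (iter n U u) v = dot u (iter n U v).
Proof. by elim: n v => //= n IH v; rewrite Usym IH -iterSr. Qed.

Lemma dot_iter n m u : dot (iter n U u) (iter m U u) = dot (iter (n + m) U u) u.
Proof. by rewrite -iter_sym -iterD addnC. Qed.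

Lemma sqn_iter n u : sqn (iter n U u) = c n.*2 u.
Proof. by rewrite /sqn dot_iter addnn. Qed.

Lemma moment_doubleS n u :
  c n.*2.+1 u = complex.Re (dot (U (iter n U u)) (iter n U u)).
Proof. by rewrite -iterS dot_iter addSn addnn. Qed.

Lemma moment_ge0 n u : 0 <= c n u.
Proof.
rewrite -(odd_double_half n); case: (odd n).
  by rewrite [(true + _)%N]add1n moment_doubleS; exact: Upos.
by rewrite [(false + _)%N]add0n -sqn_iter sqn_ge0.
Qed.

Lemma moment_decr n u : c n.+1 u <= c n u.
Proof.
rewrite -(odd_double_half n); case: (odd n).
  by rewrite [(true + _)%N]add1n -doubleS moment_doubleS -sqn_iter; exact: U2.
by rewrite [(false + _)%N]add0n moment_doubleS -sqn_iter; exact: U1.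
Qed.

(** The second difference of the moments of u is the moment of order n of u - U u. *)
Lemma moment_convex n u : 0 <= c n u - 2 * c n.+1 u + c n.+2 u.
Proof.
have := moment_ge0 n (u - U u).
have UBn k v w : iter k U (v - w) = iter k U v - iter k U w.
  by elim: k => //= k ->; rewrite UB.
rewrite UBn -iterSr dotBl !dotBr !cReD !cReN.
rewrite [dot (iter n U u) (U u)](dot_iter n 1) [dot _ (U u)](dot_iter n.+1 1).
rewrite addn1 addn1; lra.
Qed.

(** By convexity no decrement of the moments exceeds the first one. For a nearly maximizing unit
    vector this keeps a prescribed number of iterates away from 0. *)
Lemma moment_lower n u : sqn u - n%:R * (sqn u - c 1 u) <= c n u.
Proof.
have step k : c k u - c k.+1 u <= sqn u - c 1 u.
  elim: k => // k IH; apply: le_trans IH.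
  by have := moment_convex k u; lra.
elim: n => [|n IH]; first by rewrite mul0r subr0.
by have := step n; rewrite -natr1 mulrDl mul1r; lra.
Qed.

(** The squared distance is c(2n) + c(2m) - 2 c(n + m), and the moments, decreasing and nonnegative,
    converge. *)
Lemma iter_cauchy u e : 0 < e ->
  exists N, forall n m, (N <= n)%N -> (N <= m)%N ->
    sqn (iter n U u - iter m U u) < e.
Proof.
move=> e0.
have ni : nonincreasing_seq (fun n => c n u).
  by apply/nonincreasing_seqP => n; exact: moment_decr.
have lb : has_lbound (range (fun n => c n u)).
  by exists 0 => _ [n _ <-]; exact: moment_ge0.
have cvgc := nonincreasing_is_cvgn ni lb.
have cL n := nonincreasing_cvgn_ge ni cvgc n.
have /cvgrPdist_lt /(_ (e / 2)) := cvgc.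
rewrite divr_gt0// => /(_ isT) [N _ hN].
exists N => n m Nn Nm.
have cN k : (N <= k)%N -> c k u < limn (fun n => c n u) + e / 2.
  by move=> /hN /=; rewrite distrC => /(le_lt_trans (ler_norm _)); rewrite ltrBlDl.
rewrite sqnB !sqn_iter dot_iter.
have Nd k : (N <= k)%N -> (N <= k.*2)%N.
  by rewrite -addnn => /leq_trans; apply; exact: leq_addr.
have := cN _ (Nd _ Nn); have := cN _ (Nd _ Nm).
have := cL (n + m)%N; rewrite /=; lra.
Qed.

End power.

End semi_inner_theory.

(** Cauchy-Schwarz for the form <T u, v> at u and T u gives ||T u||^4 <= <T u, u> <T T u, T u>; the
    last factor is at most M ||T u||^2, and ||T u||^2 is divided out. *)
Lemma sqn_operator_le (R : realType) (V : lmodType R[i]) (dot : V -> V -> R[i])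
    (T : V -> V) (M : R) :
    semi_inner dot ->
    (forall u v, T (u + v) = T u + T v) ->
    (forall a u, T (a *: u) = a *: T u) ->
    (forall u v, dot (T u) v = dot u (T v)) ->
    (forall u, 0 <= complex.Re (dot (T u) u)) ->
    (forall u, complex.Re (dot (T u) u) <= M * sqn dot u) ->
  forall u, sqn dot (T u) <= M * complex.Re (dot (T u) u).
Proof.
move=> dotP TD TZ Tsym Tpos TM u.
have BP : semi_inner (fun u v => dot (T u) v).
  split=> [x y z|a x y|x y|x]; last exact: Tpos.
  - by rewrite TD (semi_innerD dotP).
  - by rewrite TZ (semi_innerZ dotP).
  - by rewrite Tsym (semi_innerC dotP).
have := Cauchy_Schwarz BP u (T u).
rewrite (dotvv dotP) normc_real ?sqn_ge0//.
have [->|n0] := eqVneq (sqn dot (T u)) 0.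
  (* If [M] is negative, the form at u lies between 0 and M ||u||^2 <= 0, so it vanishes. *)
  move=> _; have [M0|M0] := leP 0 M; first by rewrite mulr_ge0.
  have := TM u; have := Tpos u.
  have := sqn_ge0 dotP u; nra.
move=> h; have := le_trans h (ler_wpM2l (Tpos u) (TM (T u))).
have s0 : 0 < sqn dot (T u) by rewrite lt_def n0 sqn_ge0.
move=> h1; rewrite -(ler_pM2l s0) -expr2.
by apply: le_trans h1 _; rewrite mulrCA mulrA mulrC.
Qed.

Lemma cvg0_eventually (R : realType) (u : nat -> R) :
  (forall n, 0 <= u n) -> u n @[n --> \oo] --> 0 ->
  forall e : R, 0 < e -> exists N, forall n, (N <= n)%N -> u n < e.
Proof.
move=> u0 h e e0; have /cvgrPdist_lt /(_ _ e0) [N _ hN] := h.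
by exists N => n /hN /=; rewrite sub0r normrN ger0_norm.
Qed.

(** * Closed linear spans *)

Section closed_span_theory.
Context {R : realType} {V : lmodType R[i]} (dot : V -> V -> R[i]).
Hypothesis dP : semi_inner dot.
Local Notation sq := (sqn dot).

(** The coefficients may change with [e], so families that are not orthogonal are covered and no
    fixed series has to converge. *)
Definition closed_span (w : nat -> V) (f : V) :=
  forall e : R, 0 < e -> exists J c, sq (f - psum w c J) < e.

Lemma closed_span_limit w f :
  (forall e : R, 0 < e -> exists2 g, closed_span w g & sq (f - g) < e) -> closed_span w f.
Proof.
move=> h e e0; have e4 : 0 < e / 4 by rewrite divr_gt0.
have [g hg fg] := h _ e4; have [J [c hc]] := hg _ e4.
exists J, c; have -> : f - psum w c J = (f - g) + (g - psum w c J) by rewrite addrA subrK.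
by apply: le_lt_trans (sqnD_le dP _ _) _; lra.
Qed.

Lemma closed_span_psum w c J : closed_span w (psum w c J).
Proof. by move=> e e0; exists J, c; rewrite subrr (sqn0 dP). Qed.

Lemma closed_span_null w f : sq f = 0 -> closed_span w f.
Proof. by move=> f0 e e0; exists 0%N, (fun=> 0); rewrite /psum big_ord0 subr0 f0. Qed.

Lemma closed_span_gen w j : closed_span w (w j).
Proof.
have -> : w j = psum w (fun i => (i == j)%:R) j.+1; last exact: closed_span_psum.
rewrite /psum big_ord_recr /= eqxx scale1r big1 ?add0r// => i _.
by rewrite ltn_eqF// scale0r.
Qed.

Lemma closed_spanD w f g : closed_span w f -> closed_span w g -> closed_span w (f + g).
Proof.
move=> hf hg e e0; have e4 : 0 < e / 4 by rewrite divr_gt0.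
have [J [c hc]] := hf _ e4; have [L [c' hc']] := hg _ e4.
exists (maxn J L), (fun j => (if (j < J)%N then c j else 0) + (if (j < L)%N then c' j else 0)).
have -> : f + g - psum w (fun j => (if (j < J)%N then c j else 0) +
      (if (j < L)%N then c' j else 0)) (maxn J L) =
    (f - psum w c J) + (g - psum w c' L).
  rewrite -(psum_pad w c (leq_maxl J L)) -(psum_pad w c' (leq_maxr J L)).
  rewrite addrACA -opprD; congr (_ - _).
  by rewrite /psum -big_split; apply: eq_bigr => i _; rewrite scalerDl.
by apply: le_lt_trans (sqnD_le dP _ _) _; lra.
Qed.

Lemma closed_spanZ w k f : closed_span w f -> closed_span w (k *: f).
Proof.
move=> hf e e0.
have k1 : 0 < normc k ^+ 2 + 1 by rewrite ltr_wpDl// sqr_ge0.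
have [J [c hc]] := hf (e / (normc k ^+ 2 + 1)) (divr_gt0 e0 k1).
exists J, (fun j => k * c j).
have -> : k *: f - psum w (fun j => k * c j) J = k *: (f - psum w c J).
  rewrite scalerBr /psum scaler_sumr; congr (_ - _).
  by apply: eq_bigr => i _; rewrite scalerA.
rewrite (sqnZ dP); rewrite ltr_pdivlMr// in hc; apply: le_lt_trans hc.
by rewrite mulrC ler_wpM2l ?(sqn_ge0 dP)// lerDl.
Qed.

Lemma closed_span_trans w w' f : (forall j, closed_span w' (w j)) -> closed_span w f -> closed_span w' f.
Proof.
move=> hw hf; apply: closed_span_limit => e e0; have [J [c hc]] := hf e e0.
exists (psum w c J) => //; rewrite /psum.
elim/big_rec: _ => [|i x _ hx]; first exact: (closed_span_null _ (sqn0 dP)).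
by apply: closed_spanD => //; exact: closed_spanZ.
Qed.

(** Pythagoras: the difference of the residuals lies in the span to which the longer residual is
    orthogonal. *)
Lemma sqn_residualB nz w f m n : orthonormal_on dot nz w -> (m <= n)%N ->
  sq ((f - psum w (fun j => dot f (w j)) m) - (f - psum w (fun j => dot f (w j)) n)) =
  sq (f - psum w (fun j => dot f (w j)) m) - sq (f - psum w (fun j => dot f (w j)) n).
Proof.
move=> ow mn; set u := fun k => f - psum w (fun j => dot f (w j)) k.
rewrite -[f - psum _ _ m]/(u m) -[f - psum _ _ n]/(u n).
have d0 : dot (u n) (u m - u n) = 0.
  have -> : u m - u n = psum w (fun j => dot f (w j)) n - psum w (fun j => dot f (w j)) m.
    by rewrite /u opprB addrC addrA subrK.
  rewrite -(psum_pad w _ mn) psumB.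
  exact: (dot_residual_psum dP ow).
have -> : sq (u m) = sq ((u m - u n) + u n) by rewrite subrK.
rewrite (sqnD dP (u m - u n) (u n)) [dot (u m - u n) _](semi_innerC dP) d0 conjc0 /=.
by ring.
Qed.

(** The squared norms of the residuals decrease, and by the previous identity their differences are
    squared distances. Totality of [w] is replaced by completeness of the space later on. *)
Lemma residual_cauchy nz w f : orthonormal_on dot nz w -> forall e : R, 0 < e ->
  exists N, forall n m, (N <= n)%N -> (N <= m)%N ->
  sq ((f - psum w (fun j => dot f (w j)) n) - (f - psum w (fun j => dot f (w j)) m)) < e.
Proof.
move=> ow e e0; set u := fun k => f - psum w (fun j => dot f (w j)) k.
have um m n : (m <= n)%N -> sq (u m - u n) = sq (u m) - sq (u n) by exact: (sqn_residualB _ ow).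
have ni : nonincreasing_seq (fun n => sq (u n)).
  by move=> m n mn; rewrite -subr_ge0 -um// (sqn_ge0 dP).
have lb : has_lbound (range (fun n => sq (u n))).
  by exists 0 => _ [n _ <-]; exact: (sqn_ge0 dP).
have cu := nonincreasing_is_cvgn ni lb.
have cL n := nonincreasing_cvgn_ge ni cu n.
have /cvgrPdist_lt /(_ _ e0) [N _ hN] := cu.
have cN k : (N <= k)%N -> sq (u k) < limn (fun n => sq (u n)) + e.
  by move=> /hN /=; rewrite distrC => /(le_lt_trans (ler_norm _)); rewrite ltrBlDl.
have main n m : (N <= n)%N -> (N <= m)%N -> (n <= m)%N -> sq (u n - u m) < e.
  move=> Nn Nm nm; rewrite um//.
  by have := cN _ Nn; have := cL m; rewrite /=; lra.
exists N => n m Nn Nm; have [nm|/ltnW mn] := leqP n m; first exact: main.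
by rewrite (sqnBC dP); exact: main.
Qed.

End closed_span_theory.

(** * Enumerating and interleaving indices *)

Section enumeration.
Variable p : pred nat.
Hypothesis p_inf : forall N, exists k, (N <= k)%N && p k.

Let next N := ex_minn (p_inf N).

Fixpoint enumerate n : nat := if n is m.+1 then next (enumerate m).+1 else next 0.

Let nextP N : [/\ (N <= next N)%N, p (next N) & forall k, (N <= k)%N -> p k -> (next N <= k)%N].
Proof.
rewrite /next; case: ex_minnP => k /andP[Nk pk] h; split=> // l Nl pl.
by apply: h; rewrite Nl pl.
Qed.

Lemma enumerate_p n : p (enumerate n).
Proof.
by case: n => [|n] /=; [have [_ h _] := nextP 0|have [_ h _] := nextP (enumerate n).+1].
Qed.

Lemma enumerate_ltS n : (enumerate n < enumerate n.+1)%N.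
Proof. by have [] := nextP (enumerate n).+1. Qed.

Lemma enumerate_lt m n : (m < n)%N -> (enumerate m < enumerate n)%N.
Proof.
elim: n => // n IH; rewrite ltnS leq_eqVlt => /predU1P[->|/IH h]; first exact: enumerate_ltS.
exact: ltn_trans h (enumerate_ltS n).
Qed.

Lemma enumerate_inj : injective enumerate.
Proof.
move=> m n e; apply/eqP; rewrite eqn_leq leqNgt [(n <= m)%N]leqNgt.
by apply/andP; split; apply/negP => /enumerate_lt; rewrite e ltnn.
Qed.

Lemma enumerate_ge n : (n <= enumerate n)%N.
Proof. by elim: n => // n IH; exact: leq_ltn_trans IH (enumerate_ltS n). Qed.

Lemma enumerate_gap n k : (k < enumerate n)%N -> (if n is m.+1 then (enumerate m < k)%N else true) ->
  ~~ p k.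
Proof.
move=> kn h; apply/negP => pk; move: kn; rewrite ltnNge.
case: n h => [|n] h /=.
  by have [_ _ ->] := nextP 0.
by have [_ _ ->] := nextP (enumerate n).+1.
Qed.

Lemma enumerate_surj k : p k -> exists n, enumerate n = k.
Proof.
move=> pk; have [n nk hn] : exists2 n, (k <= enumerate n)%N &
    forall m, (m < n)%N -> (enumerate m < k)%N.
  have ex : exists n, (k <= enumerate n)%N by exists k; exact: enumerate_ge.
  case: (ex_minnP ex) => n nk hn; exists n => // m mn.
  by rewrite ltnNge; apply/negP => /hn; rewrite leqNgt mn.
exists n; apply/eqP; rewrite eqn_leq nk andbT leqNgt; apply/negP => kn.
have := @enumerate_gap n k kn; rewrite pk.
by case: n nk hn kn => [_ _ _ /(_ isT)|n _ hn _ /(_ (hn n (ltnSn n)))].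
Qed.

(** The skipped indices carry zero terms; both bounds are strict, so the term at [enumerate n] is
    left out on each side. *)
Lemma enumerate_sum (R : nmodType) (F : nat -> R) n : (forall k, ~~ p k -> F k = 0) ->
  \sum_(k < enumerate n) F k = \sum_(j < n) F (enumerate j).
Proof.
move=> F0; elim: n => [|n IH].
  by rewrite big_ord0 big1// => k _; apply/F0/(@enumerate_gap 0).
rewrite [RHS]big_ord_recr -IH /=.
rewrite -(big_mkord xpredT F) (big_cat_nat (leq0n (enumerate n).+1) (enumerate_ltS n)) /=.
rewrite big_nat_recr //= big_mkord [X in _ + X]big_nat_cond [X in _ + X]big1 ?addr0//.
by move=> k /andP[/andP[h1 h2] _]; apply/F0/(@enumerate_gap n.+1).
Qed.

End enumeration.

Lemma interleave_sum (R : nmodType) (F : nat -> R) n : (forall k, odd k -> F k = 0) ->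
  \sum_(k < n) F k = \sum_(j < uphalf n) F j.*2.
Proof.
move=> F0; elim: n => [|n IH]; first by rewrite !big_ord0.
rewrite big_ord_recr /= IH; have [on|on] := boolP (odd n).
  have -> : n./2.+1 = uphalf n by rewrite uphalf_half on add1n.
  by rewrite F0// addr0.
have e : uphalf n = n./2 by rewrite uphalf_half (negPf on).
rewrite e big_ord_recr /=; congr (_ + F _).
by rewrite -[LHS](odd_double_half n) (negPf on).
Qed.

(** * Complex integration and the space L^2 *)

Section complex_measurability.
Context {R : realType} {d} {T : measurableType d}.
Implicit Types (f g : T -> R[i]).

Lemma cmeasurableD f g :
  cmeasurable f -> cmeasurable g -> cmeasurable (fun x => f x + g x).
Proof.
move=> [f1 f2] [g1 g2]; split.
  by under eq_fun do rewrite cReD; exact: measurable_funD.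
by under eq_fun do rewrite cImD; exact: measurable_funD.
Qed.

Lemma cmeasurableM f g :
  cmeasurable f -> cmeasurable g -> cmeasurable (fun x => f x * g x).
Proof.
move=> [f1 f2] [g1 g2]; split.
  under eq_fun do rewrite cReM.
  by apply: measurable_funB; exact: measurable_funM.
under eq_fun do rewrite cImM.
by apply: measurable_funD; exact: measurable_funM.
Qed.

Lemma cmeasurable_conj f : cmeasurable f -> cmeasurable (fun x => (f x)^*).
Proof.
move=> [f1 f2]; split; first by under eq_fun do rewrite Re_conjc.
by under eq_fun do rewrite Im_conjc; exact: measurableT_comp.
Qed.

Lemma cmeasurable_cst (a : R[i]) : cmeasurable (fun _ : T => a).
Proof. by split; exact: measurable_cst. Qed.

Lemma cmeasurableN f : cmeasurable f -> cmeasurable (fun x => - f x).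
Proof.
move=> [f1 f2]; split.
  by under eq_fun do rewrite cReN; exact: measurableT_comp.
by under eq_fun do rewrite cImN; exact: measurableT_comp.
Qed.

Lemma cmeasurable_sum I (r : seq I) (F : I -> T -> R[i]) :
  (forall i, cmeasurable (F i)) -> cmeasurable (fun x => \sum_(i <- r) F i x).
Proof.
move=> mF; elim: r => [|i r IH].
  by under eq_fun do rewrite big_nil; exact: cmeasurable_cst.
by under eq_fun do rewrite big_cons; exact: cmeasurableD.
Qed.

Lemma measurable_normc_sqr f :
  cmeasurable f -> measurable_fun setT (fun x => normc (f x) ^+ 2).
Proof.
move=> [f1 f2]; under eq_fun do rewrite normc_sqr.
by apply: measurable_funD; apply: measurable_funX.
Qed.

Lemma measurable_normc f :
  cmeasurable f -> measurable_fun setT (fun x => normc (f x)).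
Proof.
move=> /measurable_normc_sqr mf.
have -> : (fun x => normc (f x)) = (fun x => Num.sqrt (normc (f x) ^+ 2)).
  by apply/funext => x; rewrite sqrtr_sqr ger0_norm ?normc_ge0.
exact: (measurableT_comp (continuous_measurable_fun (@sqrt_continuous R)) mf).
Qed.

Lemma cmeasurable_comp d' (T' : measurableType d') (h : T' -> T) f :
  measurable_fun setT h -> cmeasurable f -> cmeasurable (fun x => f (h x)).
Proof.
move=> mh [f1 f2]; split.
  exact: (@measurableT_comp _ _ _ _ _ _ (fun x => complex.Re (f x))).
exact: (@measurableT_comp _ _ _ _ _ _ (fun x => complex.Im (f x))).
Qed.

End complex_measurability.

Section complex_integral.
Context {R : realType} {d} {T : measurableType d} (mu : {measure set T -> \bar R}).
Implicit Types (f g : T -> R[i]).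

Lemma le_cintegrable f (g : T -> R) : cmeasurable f ->
  mu.-integrable setT (EFin \o g) -> (forall x, normc (f x) <= g x) ->
  cintegrable mu f.
Proof.
move=> [f1 f2] gi fg; split; apply: (le_integrable measurableT _ _ gi).
- exact/measurable_EFinP.
- move=> x _ /=; rewrite lee_fin; apply: (le_trans (normr_Re_le _)).
  exact: le_trans (fg x) (ler_norm _).
- exact/measurable_EFinP.
- move=> x _ /=; rewrite lee_fin; apply: (le_trans (normr_Im_le _)).
  exact: le_trans (fg x) (ler_norm _).
Qed.

Lemma cintegrableD f g : cintegrable mu f -> cintegrable mu g ->
  cintegrable mu (fun x => f x + g x).
Proof.
move=> [f1 f2] [g1 g2]; split.
  by under eq_fun do rewrite cReD; have := integrableD measurableT f1 g1.
by under eq_fun do rewrite cImD; have := integrableD measurableT f2 g2.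
Qed.

Lemma cintegralD f g : cintegrable mu f -> cintegrable mu g ->
  cintegral mu (fun x => f x + g x) = cintegral mu f + cintegral mu g.
Proof.
move=> [f1 f2] [g1 g2]; rewrite /cintegral.
under eq_Rintegral do rewrite cReD.
under [X in _ +i* X]eq_Rintegral do rewrite cImD.
by rewrite !RintegralD.
Qed.

Lemma cintegrable_conj f : cintegrable mu f -> cintegrable mu (fun x => (f x)^*).
Proof.
move=> [f1 f2]; split; first by under eq_fun do rewrite Re_conjc.
by under eq_fun do rewrite Im_conjc; have := integrableN f2.
Qed.

Lemma cintegral_conj f : cintegrable mu f ->
  cintegral mu (fun x => (f x)^*) = (cintegral mu f)^*.
Proof.
move=> [_ f2]; rewrite /cintegral/=; congr (_ +i* _).
  by apply: eq_Rintegral => x _; rewrite Re_conjc.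
under eq_Rintegral do rewrite Im_conjc -mulN1r.
by rewrite RintegralZl// mulN1r.
Qed.

Lemma cintegrableZ (a : R[i]) f : cintegrable mu f -> cintegrable mu (fun x => a * f x).
Proof.
move=> [f1 f2]; split.
  under eq_fun do rewrite cReM.
  have := integrableB measurableT (integrableZl measurableT (complex.Re a) f1)
    (integrableZl measurableT (complex.Im a) f2).
  by [].
under eq_fun do rewrite cImM.
by have := integrableD measurableT (integrableZl measurableT (complex.Re a) f2)
    (integrableZl measurableT (complex.Im a) f1).
Qed.

Lemma cintegralZ (a : R[i]) f : cintegrable mu f ->
  cintegral mu (fun x => a * f x) = a * cintegral mu f.
Proof.
move=> [f1 f2]; rewrite /cintegral.
under eq_Rintegral do rewrite cReM.
under [X in _ +i* X]eq_Rintegral do rewrite cImM.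
have iZ (b : R) (h : T -> R) : mu.-integrable setT (EFin \o h) ->
    mu.-integrable setT (EFin \o (fun x => b * h x)).
  by move=> hi; have := integrableZl measurableT b hi.
rewrite RintegralB ?RintegralD ?RintegralZl//; try exact: iZ.
by case: a.
Qed.

End complex_integral.

Section L2_space.
Context {R : realType} {d} {T : measurableType d}.
Variable mu : {measure set T -> \bar R}.
Implicit Types (f g : T -> R[i]).

Lemma L2P f : L2 mu f <->
  cmeasurable f /\ mu.-integrable setT (EFin \o (fun x => normc (f x) ^+ 2)).
Proof.
split=> -[mf h]; split => //.
  apply/integrableP; split; first exact/measurable_EFinP/measurable_normc_sqr.
  by under eq_integral do rewrite /= ger0_norm ?sqr_ge0//.
move/integrableP: h => [_]; apply: le_lt_trans.
by rewrite /sqnorm2; under eq_integral do rewrite -(@ger0_norm _ (_ ^+ 2)) ?sqr_ge0//.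
Qed.

Lemma le_L2 f (g : T -> R) : cmeasurable f ->
  mu.-integrable setT (EFin \o g) -> (forall x, normc (f x) ^+ 2 <= g x) -> L2 mu f.
Proof.
move=> mf gi fg; apply/L2P; split => //.
apply: (le_integrable measurableT _ _ gi).
  exact/measurable_EFinP/measurable_normc_sqr.
move=> x _ /=; rewrite lee_fin ger0_norm ?sqr_ge0//.
exact: le_trans (fg x) (ler_norm _).
Qed.

Lemma L2_comb (a : R[i]) f g :
  L2 mu f -> L2 mu g -> L2 mu (fun x => a * f x + g x).
Proof.
move=> /L2P[mf fi] /L2P[mg gi].
have h := integrableD measurableT
  (integrableZl measurableT (2 * normc a ^+ 2) fi) (integrableZl measurableT 2 gi).
apply: (le_L2 _ h).
  by apply: cmeasurableD => //; apply: cmeasurableM => //; exact: cmeasurable_cst.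
move=> x; apply: le_trans (normcD_sqr _ _) _.
by rewrite ComplexField.Normc.normcM exprMn mulrA.
Qed.

Lemma cintegrable_dot f g :
  L2 mu f -> L2 mu g -> cintegrable mu (fun x => f x * (g x)^*).
Proof.
move=> /L2P[mf fi] /L2P[mg gi].
have h := integrableD measurableT fi gi.
apply: (le_cintegrable _ h).
  by apply: cmeasurableM => //; exact: cmeasurable_conj.
move=> x; rewrite ComplexField.Normc.normcM normc_conjc /=.
have := normc_ge0 (f x); have := normc_ge0 (g x); have := sqr_ge0 (normc (f x) - normc (g x)).
by nra.
Qed.

Definition L2mem : {pred (T -> R[i])} := fun f => `[< L2 mu f >].

Lemma L2_0 : L2 mu (fun=> 0).
Proof.
apply: (@le_L2 _ (fun=> 0)); first exact: cmeasurable_cst.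
  exact: integrable0.
by move=> x; rewrite ComplexField.Normc.normc0 expr0n.
Qed.

Lemma L2mem_submod_closed : GRing.submod_closed L2mem.
Proof.
split; first by apply/asboolP; exact: L2_0.
move=> a f g /asboolP lf /asboolP lg; apply/asboolP.
exact: L2_comb.
Qed.

HB.instance Definition _ := GRing.isSubmodClosed.Build _ _ L2mem
  L2mem_submod_closed.

(** A submodule of the function space rather than a quotient: every element has a value at each
    point, as pointwise eigenvalue equations require. *)
Record L2fun := MkL2fun { L2val :> T -> R[i]; _ : L2val \in L2mem }.

HB.instance Definition _ := [isSub for L2val].
HB.instance Definition _ := [Choice of L2fun by <:].
HB.instance Definition _ := [SubChoice_isSubLmodule of L2fun by <:].

Implicit Types u v : L2fun.

Lemma L2valP u : L2 mu u.
Proof. by case: u => f /= /asboolP. Qed.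

Definition toL2 f (lf : L2 mu f) : L2fun := MkL2fun (introT (asboolP _) lf).

Lemma L2valD u v x : (u + v) x = u x + v x. Proof. by []. Qed.
Lemma L2valB u v x : (u - v) x = u x - v x. Proof. by []. Qed.
Lemma L2valZ (a : R[i]) u x : (a *: u) x = a * u x. Proof. by []. Qed.
Lemma L2val_sum I (r : seq I) (Q : pred I) (F : I -> L2fun) x :
  (\sum_(i <- r | Q i) F i) x = \sum_(i <- r | Q i) F i x.
Proof. by elim/big_rec2: _ => //= i y1 y2 _ <-. Qed.

Lemma L2cmeas u : cmeasurable u.
Proof. by have [] := L2valP u. Qed.

Definition dotL2 u v : R[i] := L2dot mu u v.

Lemma dotL2_integrable u v : cintegrable mu (fun x => u x * (v x)^*).
Proof. exact: cintegrable_dot (L2valP u) (L2valP v). Qed.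

Lemma dotL2_self u : dotL2 u u =
  (fine (\int[mu]_x (normc (u x) ^+ 2)%:E))%:C.
Proof.
rewrite /dotL2 /L2dot /cintegral.
under [X in X +i* _]eq_Rintegral do rewrite mulc_conjc /=.
under [X in _ +i* X]eq_Rintegral do rewrite mulc_conjc /=.
apply: complex_ext => //=.
by rewrite /Rintegral integral0.
Qed.

Lemma sqnorm2_L2 f : L2 mu f -> sqnorm2 mu f \is a fin_num.
Proof.
move=> [_ h]; rewrite ge0_fin_numE//.
by apply: integral_ge0 => x _; rewrite lee_fin sqr_ge0.
Qed.

Lemma dotL2_semi_inner : semi_inner dotL2.
Proof.
split=> [u v w|a u v|u v|u].
- rewrite /dotL2 /L2dot -cintegralD; [|exact: dotL2_integrable..].
  by congr cintegral; apply/funext => x; rewrite L2valD mulrDl.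
- rewrite /dotL2 /L2dot -cintegralZ; last exact: dotL2_integrable.
  by congr cintegral; apply/funext => x; rewrite L2valZ mulrA.
- rewrite /dotL2 /L2dot -cintegral_conj; last exact: dotL2_integrable.
  by congr cintegral; apply/funext => x; rewrite rmorphM /= conjcK mulrC.
- rewrite dotL2_self /= fine_ge0//.
  by apply: integral_ge0 => x _; rewrite lee_fin sqr_ge0.
Qed.

Lemma sqnorm2E u : sqnorm2 mu u = (sqn dotL2 u)%:E.
Proof.
by rewrite /sqn dotL2_self /= fineK//; exact: (sqnorm2_L2 (L2valP u)).
Qed.

Lemma eq_L2fun u v : (forall x, u x = v x) -> u = v.
Proof. by move=> uv; apply/val_inj/funext. Qed.

End L2_space.

Section complex_limits.
Context {R : realType}.
Implicit Types (u : nat -> R[i]) (l : R[i]).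

Lemma normc_cvgP u l : (normc (u n - l) @[n --> \oo] --> 0) <->
  (complex.Re (u n) @[n --> \oo] --> complex.Re l) /\
  (complex.Im (u n) @[n --> \oo] --> complex.Im l).
Proof.
split=> [h|[h1 h2]].
  split; apply/cvgrPdist_lt => e e0; move/cvgrPdist_lt : h => /(_ _ e0);
    apply: filterS => n; rewrite sub0r normrN ger0_norm ?normc_ge0//;
    apply: le_lt_trans; rewrite distrC.
    by rewrite -cReN -cReD normr_Re_le.
  by rewrite -cImN -cImD normr_Im_le.
apply/cvgrPdist_lt => e e0; near=> n.
rewrite sub0r normrN ger0_norm ?normc_ge0//.
apply: le_lt_trans (normc_le_ReIm _) _.
rewrite cReD cReN cImD cImN (splitr e); apply: ltrD; rewrite distrC.
  by near: n; move/cvgrPdist_lt : h1 => /(_ (e / 2)); apply; rewrite divr_gt0.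
by near: n; move/cvgrPdist_lt : h2 => /(_ (e / 2)); apply; rewrite divr_gt0.
Unshelve. all: by end_near. Qed.

Lemma normc_cvg_le u l (b : R) : (forall n, normc (u n) <= b) ->
  normc (u n - l) @[n --> \oo] --> 0 -> normc l <= b.
Proof.
move=> ub h; apply/ler_addgt0Pr => e e0.
have [n _ hn] : \forall n \near \oo, normc (u n - l) < e.
  move/cvgrPdist_lt : h => /(_ _ e0); apply: filterS => n.
  by rewrite sub0r normrN ger0_norm ?normc_ge0.
have := hn n (leqnn _) => /= h1.
have -> : l = u n + (l - u n) by rewrite addrC subrK.
apply: le_trans (normcD_le _ _) _; apply: lerD => //.
by rewrite normcB_sym ltW.
Qed.

Lemma cvg0_sqr_normc u l :
  (normc (u n - l) @[n --> \oo] --> 0) <-> (normc (u n - l) ^+ 2 @[n --> \oo] --> 0).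
Proof.
split=> h.
  have -> : (fun n => normc (u n - l) ^+ 2) =
      (fun n => normc (u n - l)) \* (fun n => normc (u n - l)).
    by apply/funext => n; rewrite /= expr2.
  by rewrite -[X in _ --> X](mulr0 (0 : R)); exact: cvgM.
have -> : 0 = Num.sqrt (0 : R) by rewrite sqrtr0.
have -> : (fun n => normc (u n - l)) = Num.sqrt \o (fun n => normc (u n - l) ^+ 2).
  by apply/funext => n; rewrite /= sqrtr_sqr ger0_norm// normc_ge0.
by apply: continuous_cvg; [exact: sqrt_continuous|exact: h].
Qed.

(** Comparison with a geometric series of sum 2b. The bound uniform in n later provides a dominating
    function. *)
Lemma telescope_cvg u (b : R) :
  (forall k, normc (u k.+1 - u k) <= b * 2^-1 ^+ k) ->
  (exists l, normc (u n - l) @[n --> \oo] --> 0) /\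
  (forall n, normc (u n - u 0) <= 2 * b).
Proof.
move=> hb.
have b0 : 0 <= b by have := hb 0%N; rewrite expr0 mulr1; apply: le_trans; exact: normc_ge0.
have h2 : `|2^-1 : R| < 1 by rewrite ger0_norm ?invr_ge0// invf_lt1// ltr1n.
have geo := @is_cvg_geometric_series R b 2^-1 h2.
have aux (p : R[i] -> R) : (forall x y, p (x - y) = p x - p y) ->
    (forall x, `|p x| <= normc x) -> cvgn (fun n => p (u n)).
  move=> pB pn.
  have cs : cvgn (series (fun k => p (u k.+1 - u k))).
    apply: normed_cvg.
    apply: (series_le_cvg _ _ _ geo) => n //=; first by rewrite mulr_ge0.
    exact: le_trans (pn _) (hb n).
  have -> : (fun n => p (u n)) = (fun n => p (u 0) + series (fun k => p (u k.+1 - u k)) n).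
    apply/funext => n; rewrite /series /=.
    under eq_bigr do rewrite pB.
    by rewrite telescope_sumr// addrC subrK.
  by apply: is_cvgD => //; exact: is_cvg_cst.
split.
  exists (limn (fun n => complex.Re (u n)) +i* limn (fun n => complex.Im (u n))).
  apply/normc_cvgP; split => /=; apply: aux => [x y|x].
  - by rewrite cReD cReN.
  - exact: normr_Re_le.
  - by rewrite cImD cImN.
  - exact: normr_Im_le.
move=> n; apply: (@le_trans _ _ (\sum_(k < n) b * 2^-1 ^+ k)).
  elim: n => [|n IH].
    by rewrite subrr ComplexField.Normc.normc0 big_ord0.
  rewrite big_ord_recr /=.
  have -> : u n.+1 - u 0 = (u n - u 0) + (u n.+1 - u n) by ring.
  by apply: le_trans (normcD_le _ _) _; exact: lerD.
rewrite -mulr_sumr [leRHS]mulrC ler_wpM2l//.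
have : 2^-1 ^+ n - 1 = (2^-1 - 1) * (\sum_(i < n) 2^-1 ^+ i) :> R by rewrite subrX1.
have : 0 <= 2^-1 ^+ n :> R by rewrite exprn_ge0// invr_ge0.
by lra.
Qed.

End complex_limits.

(** * Dominated convergence and completeness in L^2 *)

Section L2_limits.
Context {R : realType} {d} {T : measurableType d}.
Variable mu : {measure set T -> \bar R}.
Local Notation dot := (@dotL2 R d T mu).

Lemma cmeasurable_cvg (u : nat -> T -> R[i]) (f : T -> R[i]) :
  (forall n, cmeasurable (u n)) ->
  (forall x, normc (u n x - f x) @[n --> \oo] --> 0) -> cmeasurable f.
Proof.
move=> mu_ h; split.
  apply: (@measurable_fun_cvg _ _ _ _ (fun n x => complex.Re (u n x))) => [n|x _].
    by have [] := mu_ n.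
  by have /normc_cvgP[] := h x.
apply: (@measurable_fun_cvg _ _ _ _ (fun n x => complex.Im (u n x))) => [n|x _].
  by have [] := mu_ n.
by have /normc_cvgP[] := h x.
Qed.

Lemma L2_dominated (u : nat -> L2fun mu) (f : T -> R[i]) (g : T -> R) :
    mu.-integrable setT (EFin \o g) ->
    (forall n x, normc (u n x) ^+ 2 <= g x) ->
    (forall x, normc (u n x - f x) @[n --> \oo] --> 0) ->
  exists2 v : L2fun mu, (forall x, v x = f x) & sqn dot (u n - v) @[n --> \oo] --> 0.
Proof.
move=> gi ug uf.
have g0 x : 0 <= g x by apply: le_trans (ug 0%N x); rewrite sqr_ge0.
have fg x : normc (f x) ^+ 2 <= g x.
  rewrite -[leRHS]sqr_sqrtr// ler_pXn2r ?nnegrE ?normc_ge0 ?sqrtr_ge0//.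
  apply: (normc_cvg_le _ (uf x)) => n.
  by rewrite -(@ler_pXn2r _ 2) ?nnegrE ?normc_ge0 ?sqrtr_ge0// sqr_sqrtr.
have mf : cmeasurable f by apply: cmeasurable_cvg uf => n; exact: L2cmeas.
have lf := le_L2 mf gi fg.
exists (toL2 lf) => //.
(* The constant 4 comes from |u - f|^2 <= 2 |u|^2 + 2 |f|^2, both squares being at most g. *)
have gi4 : mu.-integrable setT (EFin \o (fun x => 4 * g x)).
  by have := integrableZl measurableT 4 gi.
have := @dominated_cvg _ _ _ mu setT measurableT
  (fun n x => (normc (u n x - f x) ^+ 2)%:E) (fun=> 0%E) (fun x => (4 * g x)%:E).
move=> /(_ _ _ _ gi4); rewrite integral0 => h.
have {}h : (\int[mu]_x (normc (u n x - f x) ^+ 2)%:E)%E @[n --> \oo] --> 0%E.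
  apply: h => //.
  - move=> n; apply/measurable_EFinP/measurable_normc_sqr.
    by apply: cmeasurableD; [exact: L2cmeas|exact: cmeasurableN].
  - move=> x _; apply: cvg_EFin; first exact: nearW.
    exact: (cvg0_sqr_normc (fun n => u n x) (f x)).1 (uf x).
  - move=> n x _; rewrite /= lee_fin ger0_norm ?sqr_ge0//.
    apply: le_trans (normcD_sqr _ _) _; rewrite normcN.
    by have := ug n x; have := fg x; lra.
have -> : (fun n => sqn dot (u n - toL2 lf)) =
    fine \o (fun n => \int[mu]_x (normc (u n x - f x) ^+ 2)%:E)%E.
  by apply/funext => n /=; rewrite -[RHS]/(fine (sqnorm2 mu (u n - toL2 lf))) sqnorm2E.
exact: fine_cvg h.
Qed.

Lemma nneseries_le_bound (a : nat -> \bar R) (M : \bar R) N :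
  (forall n, 0 <= a n)%E -> (forall n, \sum_(N <= k < n) a k <= M)%E ->
  (\sum_(N <= k <oo) a k <= M)%E.
Proof.
move=> a0 aM; apply: lime_le; first by apply: is_cvg_nneseries => n _ _.
by apply: nearW => n; exact: aM.
Qed.

Lemma sqn_ae0 (u : L2fun mu) : {ae mu, forall x, u x = 0} -> sqn dot u = 0.
Proof.
move=> h; apply: EFin_inj; rewrite -sqnorm2E /sqnorm2.
rewrite -[RHS](integral0 mu setT); apply: ae_eq_integral => //.
  by apply/measurable_EFinP/measurable_normc_sqr/L2cmeas.
by apply: filterS h => x ux _ /=; rewrite ux ComplexField.Normc.normc0 expr0n.
Qed.

(** Riesz-Fischer: a fast subsequence converges pointwise under a square-integrable bound, and the
    Cauchy property transfers its limit to the whole sequence. *)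
Lemma L2_complete (u : nat -> L2fun mu) :
    (forall e, 0 < e -> exists N, forall n m, (N <= n)%N -> (N <= m)%N ->
      sqn dot (u n - u m) < e) ->
  exists v, sqn dot (u n - v) @[n --> \oo] --> 0.
Proof.
move=> cauchy.
have dP := dotL2_semi_inner mu.
have e0 k : 0 < (16^-1 : R) ^+ k by rewrite exprn_gt0// invr_gt0.
have /choice [N hN] k := cauchy _ (e0 k).
(* The running maximum makes the chosen indices monotone, so that [M k.+1] also lies beyond
   [N k]. *)
pose M k := (\max_(i < k.+1) N i)%N.
have NM k : (N k <= M k)%N by exact: (leq_bigmax (@ord_max k)).
have MS k : (M k <= M k.+1)%N by rewrite [M k.+1]/M big_ord_recr leq_maxl.
pose w k := u (M k).
have hw k : sqn dot (w k.+1 - w k) <= 16^-1 ^+ k.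
  by apply/ltW/hN; [exact: leq_trans (NM k) (MS k)|exact: NM].
(* With the weights 4^k the integrals are at most 4^k 16^-k = 4^-k, still summable, while a finite
   sum at x forces increments of order 2^-k there. *)
pose s k x := (4 ^+ k * normc (w k.+1 x - w k x) ^+ 2)%:E.
have s0 k x : (0 <= s k x)%E by rewrite lee_fin mulr_ge0// sqr_ge0.
pose S x := (\sum_(0 <= k <oo) s k x)%E.
have S0 x : (0 <= S x)%E by apply: nneseries_ge0 => k _ _; exact: s0.
have ms k : measurable_fun setT (s k).
  apply/measurable_EFinP/measurable_funM; first exact: measurable_cst.
  apply: measurable_normc_sqr.
  by apply: cmeasurableD; [exact: L2cmeas|apply: cmeasurableN; exact: L2cmeas].
have mS : measurable_fun setT S by apply: ge0_emeasurable_sum.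
have iS : mu.-integrable setT S.
  apply/integrableP; split => //.
  under eq_integral do rewrite gee0_abs//.
  rewrite /S integral_nneseries//.
  apply: (@le_lt_trans _ _ 2%:E); last exact: ltry.
  apply: nneseries_le_bound => [k|n]; first exact: integral_ge0.
  apply: (@le_trans _ _ (\sum_(0 <= k < n) ((4^-1) ^+ k)%:E)%E).
    apply: lee_sum => k _; rewrite /s.
    under eq_integral do rewrite EFinM.
    rewrite ge0_integralZl//.
    - rewrite -[X in (_ * X)%E]/(sqnorm2 mu (w k.+1 - w k)) sqnorm2E -EFinM lee_fin.
      apply: (@le_trans _ _ (4 ^+ k * 16^-1 ^+ k)); first by rewrite ler_wpM2l.
      by rewrite -exprMn (_ : 4 * 16^-1 = 4^-1)//; field.
    - apply/measurable_EFinP/measurable_normc_sqr.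
      by apply: cmeasurableD; [exact: L2cmeas|apply: cmeasurableN; exact: L2cmeas].
    - by move=> x _; rewrite lee_fin sqr_ge0.
  rewrite sumEFin lee_fin big_mkord.
  have : 4^-1 ^+ n - 1 = (4^-1 - 1) * (\sum_(i < n) 4^-1 ^+ i) :> R by rewrite subrX1.
  have : 0 <= 4^-1 ^+ n :> R by rewrite exprn_ge0// invr_ge0.
  by lra.
(* Multiplying by the indicator of [G], whose complement is null, makes the convergence hold at
   every point. *)
pose G := [set x | S x \is a fin_num].
have mG : measurable G by rewrite -[G]setTI; exact: emeasurable_fin_num.
have lw k : L2 mu (fun x => (\1_G x)%:C * w k x).
  have /L2P[_ wi] := L2valP (w k).
  apply: (le_L2 _ wi).
    apply: cmeasurableM; last exact: L2cmeas.
    by split; [exact: measurable_indic|exact: measurable_cst].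
  move=> x; rewrite ComplexField.Normc.normcM normc_real// indicE exprMn.
  by rewrite ler_piMl ?sqr_ge0//; case: (x \in G); rewrite ?expr1n ?expr0n.
pose w' k := toL2 (lw k).
have w'E k x : w' k x = (\1_G x)%:C * w k x by [].
have S'0 x : 0 <= fine (S x) by exact: fine_ge0.
have step x k : normc (w' k.+1 x - w' k x) <= Num.sqrt (fine (S x)) * 2^-1 ^+ k.
  rewrite !w'E -mulrBr ComplexField.Normc.normcM normc_real// indicE.
  have [xG|xG] := boolP (x \in G); last first.
    by rewrite mul0r mulr_ge0 ?sqrtr_ge0// exprn_ge0// invr_ge0.
  rewrite mul1r -(@ler_pXn2r _ 2) ?nnegrE ?normc_ge0 ?mulr_ge0 ?sqrtr_ge0 ?exprn_ge0 ?invr_ge0//.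
  rewrite exprMn sqr_sqrtr// -exprM mulnC exprM.
  have -> : (2^-1 : R) ^+ 2 = 4^-1 by field.
  rewrite exprVn ler_pdivlMr ?exprn_gt0// mulrC -lee_fin fineK; last by move: xG; rewrite inE.
  have := @nneseries_lim_ge _ (s^~ x) xpredT 0 k.+1 (fun n _ _ => s0 n x).
  apply: le_trans; rewrite big_nat_recr//= leeDr//.
  by apply: sume_ge0 => i _; exact: s0.
have tele x := telescope_cvg (step x).
have /choice [f hf] x := (tele x).1.
have fi : mu.-integrable setT (EFin \o (fine \o S)).
  apply: (le_integrable measurableT _ _ iS).
    apply/measurable_EFinP; exact: measurableT_comp.
  move=> x _ /=; rewrite ger0_norm// gee0_abs//.
  by have := S0 x; case: (S x) => //= ; rewrite ?leey.
have /L2P[_ w0i] := L2valP (w' 0).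
(* The term 8 S is 2 (2 sqrt S)^2, from the uniform bound of [telescope_cvg]. *)
have gi := integrableD measurableT (integrableZl measurableT 2 w0i)
  (integrableZl measurableT 8 fi).
have [|v vf hv] := @L2_dominated w' f _ gi _ hf.
  move=> n x; have h1 := normcD_sqr (w' n x - w' 0 x) (w' 0 x).
  rewrite subrK in h1; apply: (le_trans h1).
  change (2 * normc (w' n x - w' 0 x) ^+ 2 + 2 * normc (w' 0 x) ^+ 2
    <= 2 * normc (w' 0 x) ^+ 2 + 8 * fine (S x)).
  have := (tele x).2 n.
  rewrite -(@ler_pXn2r _ 2) ?nnegrE ?normc_ge0 ?mulr_ge0 ?sqrtr_ge0//.
  by rewrite exprMn sqr_sqrtr//; lra.
exists v.
have ww n : sqn dot (w n - w' n) = 0.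
  apply: sqn_ae0; have := integrable_ae measurableT iS.
  apply: filterS => x /(_ Logic.I) Sx.
  by rewrite L2valB w'E indicE mem_set// mul1r subrr.
apply/cvgrPdist_lt => e e_gt0.
have e8 : 0 < e / 8 by rewrite divr_gt0.
have c16 : (16^-1 : R) ^+ k @[k --> \oo] --> 0.
  by apply: cvg_expr; rewrite ger0_norm ?invr_ge0// invf_lt1// ltr1n.
have [k [k1 k2]] : exists k, (16^-1 : R) ^+ k < e / 8 /\ sqn dot (w' k - v) < e / 8.
  have [k _ hk] : \forall k \near \oo, (16^-1 : R) ^+ k < e / 8 /\ sqn dot (w' k - v) < e / 8.
    near=> k; split.
      near: k; move/cvgrPdist_lt : c16 => /(_ _ e8); apply: filterS => k.
      by rewrite sub0r normrN => /(le_lt_trans (ler_norm _)).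
    near: k; move/cvgrPdist_lt : hv => /(_ _ e8); apply: filterS => k.
    by rewrite sub0r normrN => /(le_lt_trans (ler_norm _)).
  by exists k; exact: (hk k (leqnn _)).
near=> n; rewrite sub0r normrN ger0_norm ?(sqn_ge0 dP)//.
have h1 : sqn dot (u n - w k) < 16^-1 ^+ k.
  by apply: hN; [near: n; exists (N k)|exact: NM].
have -> : u n - v = (u n - w k) + ((w k - w' k) + (w' k - v)).
  by rewrite !addrA !subrK.
apply: le_lt_trans (sqnD_le dP _ _) _.
have := sqnD_le dP (w k - w' k) (w' k - v); rewrite ww.
by lra.
Unshelve. all: by end_near. Qed.

End L2_limits.

(** * Square-integrable processes and their kernels *)

Section parametric_integrals.
Context {R : realType} {d1 d2} {T1 : measurableType d1} {T2 : measurableType d2}.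
Variables (m1 : {sigma_finite_measure set T1 -> \bar R})
  (m2 : {sigma_finite_measure set T2 -> \bar R}).

(** Splitting into positive and negative parts gives measurability without integrability; [fine]
    assigns 0 where the inner integral is infinite. *)
Lemma measurable_Rintegral_l (f : T1 * T2 -> R) : measurable_fun setT f ->
  measurable_fun setT (fun x => \int[m2]_y f (x, y)).
Proof.
move=> mf; have mEf : measurable_fun setT (EFin \o f) by exact/measurable_EFinP.
have -> : (fun x => \int[m2]_y f (x, y)) = fine \o
    (fun x => fubini_F m2 (EFin \o f)^\+ x - fubini_F m2 (EFin \o f)^\- x)%E.
  by apply/funext => x; rewrite /= /Rintegral [in LHS]integralE; congr (fine (_ - _)%E);
    apply: eq_integral => y _; rewrite ?funeposE ?funenegE.
have mF : measurable_fun setT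
    (fun x => fubini_F m2 (EFin \o f)^\+ x - fubini_F m2 (EFin \o f)^\- x)%E.
  apply: emeasurable_funB; apply: measurable_fun_fubini_tonelli_F => //.
    exact: measurable_funepos.
  exact: measurable_funeneg.
exact: (measurableT_comp (fine_measurable measurableT) mF).
Qed.

Lemma measurable_cintegral_l (f : T1 * T2 -> R[i]) : cmeasurable f ->
  cmeasurable (fun x => cintegral m2 (fun y => f (x, y))).
Proof.
by move=> [f1 f2]; split; [exact: (measurable_Rintegral_l f1)|exact: (measurable_Rintegral_l f2)].
Qed.

(** The inner real integral differs from the extended one only where the latter is infinite;
    absolute integrability confines this to a null set. *)
Lemma ge0_fubini_Rintegral (f : T1 * T2 -> R) :
    measurable_fun setT f -> (\int[m1]_x \int[m2]_y `|f (x, y)|%:E < +oo)%E ->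
  m1.-integrable setT (EFin \o (fun x => \int[m2]_y f (x, y))) /\
  \int[m1]_x \int[m2]_y f (x, y) = fine (\int[m1]_x \int[m2]_y (f (x, y))%:E).
Proof.
move=> mf fi; have mEf : measurable_fun setT (EFin \o f) by exact/measurable_EFinP.
have ip : (m1 \x m2)%E.-integrable setT (EFin \o f) by exact/integrable12ltyP.
have iF := integrable_fubini_F ip.
have mi := measurable_Rintegral_l mf.
have ii : m1.-integrable setT (EFin \o (fun x => \int[m2]_y f (x, y))).
  apply: (le_integrable measurableT _ _ iF); first exact/measurable_EFinP.
  move=> x _; rewrite /= /Rintegral /fubini_F /=.
  by case: (\int[m2]_y (f (x, y))%:E)%E => //=; rewrite normr0 leey.
split=> //; rewrite /Rintegral; congr fine.
apply: ae_eq_integral => //.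
- exact/measurable_EFinP.
- exact: measurable_int iF.
- have := integrable_ae measurableT iF; apply: filterS => x /(_ Logic.I) h _.
  by rewrite /= fineK.
Qed.

End parametric_integrals.

Section fubini.
Context {R : realType} {d1 d2} {T1 : measurableType d1} {T2 : measurableType d2}.
Variables (m1 : {sigma_finite_measure set T1 -> \bar R})
  (m2 : {sigma_finite_measure set T2 -> \bar R}).

Lemma measurable_swap_fun (d3 : measure_display) (T3 : measurableType d3)
  (f : T1 * T2 -> T3) : measurable_fun setT f ->
  measurable_fun setT (fun p : T2 * T1 => f (p.2, p.1)).
Proof. by move=> mf; apply: (measurableT_comp mf); exact: measurable_swap. Qed.

Lemma cmeasurable_swap (f : T1 * T2 -> R[i]) : cmeasurable f ->
  cmeasurable (fun p : T2 * T1 => f (p.2, p.1)).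
Proof.
by move=> [f1 f2]; split; [exact: (measurable_swap_fun f1)|exact: (measurable_swap_fun f2)].
Qed.

Lemma cmeasurable_pair1 (f : T1 * T2 -> R[i]) x : cmeasurable f ->
  cmeasurable (fun y => f (x, y)).
Proof. by apply: cmeasurable_comp; exact: pair1_measurable. Qed.

Lemma cmeasurable_pair2 (f : T1 * T2 -> R[i]) y : cmeasurable f ->
  cmeasurable (fun x => f (x, y)).
Proof. by apply: cmeasurable_comp; exact: pair2_measurable. Qed.

Lemma fubini_Rintegral (f : T1 * T2 -> R) :
    measurable_fun setT f -> (\int[m1]_x \int[m2]_y `|f (x, y)|%:E < +oo)%E ->
  m1.-integrable setT (EFin \o (fun x => \int[m2]_y f (x, y))) /\
  \int[m1]_x \int[m2]_y f (x, y) = \int[m2]_y \int[m1]_x f (x, y).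
Proof.
move=> mf fi; have mEf : measurable_fun setT (EFin \o f) by exact/measurable_EFinP.
have [i1 ->] := ge0_fubini_Rintegral mf fi; split=> //.
have mf' := measurable_swap_fun mf.
have [|_ /= ->] := @ge0_fubini_Rintegral _ _ _ _ _ m2 m1 (fun p => f (p.2, p.1)) mf'.
  move: fi; rewrite (fubini_tonelli (fun p => `|f p|%:E))//.
  by apply/measurable_EFinP; exact: measurableT_comp.
have ip : (m1 \x m2)%E.-integrable setT (EFin \o f) by exact/integrable12ltyP.
by congr fine; exact: (Fubini ip).
Qed.

Lemma fubini_cintegral (f : T1 * T2 -> R[i]) :
    cmeasurable f -> (\int[m1]_x \int[m2]_y (normc (f (x, y)))%:E < +oo)%E ->
  cintegrable m1 (fun x => cintegral m2 (fun y => f (x, y))) /\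
  cintegral m1 (fun x => cintegral m2 (fun y => f (x, y))) =
  cintegral m2 (fun y => cintegral m1 (fun x => f (x, y))).
Proof.
move=> mf fi; have [f1 f2] := mf.
have aux (p : R[i] -> R) : (forall z, `|p z| <= normc z) ->
    measurable_fun setT (fun x => p (f x)) ->
    (\int[m1]_x \int[m2]_y (`|p (f (x, y))|%:E) < +oo)%E.
  move=> pn mp; apply: le_lt_trans fi.
  have mp' : measurable_fun setT (fun x => `|p (f x)|%:E).
    by apply/measurable_EFinP; exact: measurableT_comp.
  have mn : measurable_fun setT (fun x => (normc (f x))%:E).
    exact/measurable_EFinP/measurable_normc.
  apply: ge0_le_integral => //.
  - by move=> x _; exact: integral_ge0.
  - exact: (measurable_fun_fubini_tonelli_F (fun x => `|p (f x)|%:E)).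
  - apply: (measurable_fun_fubini_tonelli_F (fun x => (normc (f x))%:E)) => //.
    by move=> x; rewrite lee_fin normc_ge0.
  - move=> x _; apply: ge0_le_integral => //.
    + exact: (measurableT_comp mp' (pair1_measurable x)).
    + exact: (measurableT_comp mn (pair1_measurable x)).
    + by move=> y _; rewrite lee_fin.
have [i1 e1] := fubini_Rintegral f1 (aux _ (@normr_Re_le R) f1).
have [i2 e2] := fubini_Rintegral f2 (aux _ (@normr_Im_le R) f2).
by split; [split|rewrite /cintegral /= e1 e2].
Qed.

End fubini.

Section L2_process.
Context {R : realType} {d d'} {T : measurableType d} {Omega : measurableType d'}.
Variables (mu : {sigma_finite_measure set T -> \bar R}) (P : probability Omega R).

Lemma eq_cintegral_ae d1 (T1 : measurableType d1) (m : {measure set T1 -> \bar R})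
    (f g : T1 -> R[i]) :
  cmeasurable f -> cmeasurable g -> {ae m, forall x, f x = g x} ->
  cintegral m f = cintegral m g.
Proof.
move=> [f1 f2] [g1 g2] fg; rewrite /cintegral /Rintegral.
by congr (fine _ +i* fine _); apply: ae_eq_integral => //; try exact/measurable_EFinP;
  apply: filterS fg => x fgx _; rewrite /= fgx.
Qed.

(** Measurability is joint in (w, s), since Fubini and Tonelli relate the paths to the variables
    [X s]. All three properties pass to the remainders of the expansion. *)
Record L2_process (X : T -> Omega -> R[i]) : Prop := {
  process_measurable : cmeasurable (fun p : Omega * T => X p.2 p.1);
  process_L2 : forall s, L2 P (X s);
  process_integrable : (\int[mu]_s sqnorm2 P (X s) < +oo)%E }.

Variable X : T -> Omega -> R[i].
Hypothesis hX : L2_process X.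

Local Notation mX := (process_measurable hX).

Definition Xval s : L2fun P := toL2 (process_L2 hX s).

Definition covdiag s : R := sqn (@dotL2 R _ Omega P) (Xval s).

Lemma sqnorm2_process s : sqnorm2 P (X s) = (covdiag s)%:E.
Proof. exact: (sqnorm2E (Xval s)). Qed.

Lemma covdiag_ge0 s : 0 <= covdiag s.
Proof. exact: (sqn_ge0 (dotL2_semi_inner P)). Qed.

Lemma measurable_normc_process :
  measurable_fun setT (fun p : Omega * T => (normc (X p.2 p.1) ^+ 2)%:E).
Proof. by apply/measurable_EFinP/measurable_normc_sqr; exact: mX. Qed.

Let nX0 (p : Omega * T) : (0 <= (normc (X p.2 p.1) ^+ 2)%:E)%E.
Proof. by rewrite lee_fin sqr_ge0. Qed.

Lemma integrable_covdiag : mu.-integrable setT (EFin \o covdiag).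
Proof.
apply/integrableP; split.
  have -> : EFin \o covdiag = fun s => sqnorm2 P (X s).
    by apply/funext => s; rewrite sqnorm2_process.
  exact: (measurable_fun_fubini_tonelli_G _ measurable_normc_process nX0).
have := process_integrable hX; congr (_ < _)%E; apply: eq_integral => s _.
by rewrite sqnorm2_process /= ger0_norm// covdiag_ge0.
Qed.

Lemma integral_pathwise_sqnorm2 :
  (\int[P]_w sqnorm2 mu (X ^~ w) = \int[mu]_s sqnorm2 P (X s))%E.
Proof. exact: (fubini_tonelli _ measurable_normc_process nX0). Qed.

Lemma measurable_pathwise_sqnorm2 :
  measurable_fun setT (fun w => sqnorm2 mu (X ^~ w)).
Proof. exact: (measurable_fun_fubini_tonelli_F _ measurable_normc_process nX0). Qed.

Lemma integrable_pathwise_sqnorm2 :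
  P.-integrable setT (fun w => sqnorm2 mu (X ^~ w)).
Proof.
apply/integrableP; split; first exact: measurable_pathwise_sqnorm2.
have := process_integrable hX; rewrite -integral_pathwise_sqnorm2.
congr (_ < _)%E; apply: eq_integral => w _.
by rewrite gee0_abs//; apply: integral_ge0 => x _; rewrite lee_fin sqr_ge0.
Qed.

(** By Tonelli the expected squared norm of a path is the integral of K(s, s), which is finite. *)
Lemma path_L2 : {ae P, forall w, L2 mu (X ^~ w)}.
Proof.
have := integrable_ae measurableT integrable_pathwise_sqnorm2.
apply: filterS => w /(_ Logic.I) h; split; last by rewrite ltey_eq h.
exact: (cmeasurable_pair1 w mX).
Qed.

(* [KL_coef X mu z j] is [coef (z j)]. *)
Definition coef (g : T -> R[i]) (w : Omega) : R[i] :=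
  cintegral mu (fun s => X s w * (g s)^*).

Lemma coef_measurable g : cmeasurable g -> cmeasurable (coef g).
Proof.
move=> mg; apply: (@measurable_cintegral_l _ _ _ _ _ mu (fun p => X p.2 p.1 * (g p.2)^*)).
apply: cmeasurableM; first exact: mX.
by apply: cmeasurable_conj; apply: (cmeasurable_comp _ mg); exact: measurable_snd.
Qed.

Lemma path_cintegrable g : L2 mu g ->
  {ae P, forall w, cintegrable mu (fun s => X s w * (g s)^*)}.
Proof.
by move=> lg; apply: filterS path_L2 => w lw; exact: cintegrable_dot.
Qed.

(** Pathwise Cauchy-Schwarz bounds |coef g|^2 by ||X(., w)||^2 ||g||^2, for the almost all w whose
    path is in L^2. *)
Lemma coef_L2 g : L2 mu g -> L2 P (coef g).
Proof.
move=> lg; pose G := toL2 lg; have mg := lg.1.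
split; first exact: coef_measurable.
pose c := sqn (@dotL2 _ _ _ mu) G.
have c0 : 0 <= c by exact: (sqn_ge0 (dotL2_semi_inner mu)).
have h := integrableZl measurableT c integrable_pathwise_sqnorm2.
move/integrableP : h => [mh]; apply: le_lt_trans.
have -> : (\int[P]_w `|c%:E * sqnorm2 mu (X ^~ w)| =
    \int[P]_w (c%:E * sqnorm2 mu (X ^~ w)))%E.
  apply: eq_integral => w _; rewrite gee0_abs// mule_ge0//.
  by apply: integral_ge0 => x _; rewrite lee_fin sqr_ge0.
apply: ae_ge0_le_integral => //.
- by move=> w _; rewrite lee_fin sqr_ge0.
- by apply/measurable_EFinP/measurable_normc_sqr/coef_measurable.
- move=> w _; rewrite mule_ge0//.
  by apply: integral_ge0 => x _; rewrite lee_fin sqr_ge0.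
- apply: filterS path_L2 => w lw _.
  rewrite (sqnorm2E (toL2 lw)) -EFinM lee_fin mulrC.
  exact: (Cauchy_Schwarz (dotL2_semi_inner mu) (toL2 lw) G).
Qed.

Definition Lcoef (g : L2fun mu) : L2fun P := toL2 (coef_L2 (L2valP g)).

(** The exchange of integrals behind everything else: with Y = X_x it identifies the operator of the
    covariance kernel, with Y a coefficient it computes correlations, and with Y = 1 it gives
    means. *)
Lemma fubini_coef (Y : L2fun P) (g : L2fun mu) :
  cintegrable mu (fun t => dotL2 Y (Xval t) * g t) /\
  dotL2 Y (Lcoef g) = cintegral mu (fun t => dotL2 Y (Xval t) * g t).
Proof.
pose F (p : Omega * T) := Y p.1 * (X p.2 p.1)^* * g p.2.
have mF : cmeasurable F.
  apply: cmeasurableM.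
    apply: cmeasurableM; last exact/cmeasurable_conj/mX.
    by apply: (cmeasurable_comp _ (L2cmeas Y)); exact: measurable_fst.
  by apply: (cmeasurable_comp _ (L2cmeas g)); exact: measurable_snd.
have mF' : cmeasurable (fun p : T * Omega => F (p.2, p.1)) by exact: cmeasurable_swap.
have FT t : cintegral P (fun w => F (w, t)) = dotL2 Y (Xval t) * g t.
  rewrite mulrC /dotL2 /L2dot -cintegralZ; last exact: (dotL2_integrable Y (Xval t)).
  by congr cintegral; apply/funext => w; rewrite mulrC.
have Ffin : (\int[mu]_x \int[P]_y (normc (F (y, x)))%:E < +oo)%E.
  (* Majorant of |F|: |Y| |X| |g| <= |X|^2 + |Y|^2 |g|^2, and the double integral of the right-hand
     side is finite. *)
  pose G (p : T * Omega) := (normc (X p.1 p.2) ^+ 2 + normc (Y p.2) ^+ 2 * normc (g p.1) ^+ 2)%R.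
  have mG1 : measurable_fun setT (fun p : T * Omega => normc (X p.1 p.2) ^+ 2).
    exact: (measurable_swap_fun (measurable_normc_sqr mX)).
  have mg : measurable_fun setT (fun p : T * Omega => normc (g p.1) ^+ 2).
    apply: measurable_normc_sqr.
    by apply: (cmeasurable_comp _ (L2cmeas g)); exact: measurable_fst.
  have mY : measurable_fun setT (fun p : T * Omega => normc (Y p.2) ^+ 2).
    apply: measurable_normc_sqr.
    by apply: (cmeasurable_comp _ (L2cmeas Y)); exact: measurable_snd.
  have mG : measurable_fun setT (EFin \o G).
    apply/measurable_EFinP; exact: (measurable_funD mG1 (measurable_funM mY mg)).
  have G0 p : (0 <= (EFin \o G) p)%E 
    by rewrite /= lee_fin; apply: addr_ge0; [|apply: mulr_ge0]; exact: sqr_ge0.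
  have GE x : (\int[P]_y (G (x, y))%:E)%E =
      (covdiag x + sqn (@dotL2 _ _ _ P) Y * normc (g x) ^+ 2)%:E.
    rewrite EFinD EFinM muleC -sqnorm2_process -sqnorm2E /sqnorm2.
    rewrite -ge0_integralZl//; last 3 first.
    - by apply/measurable_EFinP/measurable_normc_sqr/L2cmeas.
    - by move=> y _; rewrite lee_fin sqr_ge0.
    - by rewrite lee_fin sqr_ge0.
    rewrite -ge0_integralD//.
    - by apply: eq_integral => y _; rewrite /G /= EFinD EFinM muleC.
    - by move=> y _; rewrite lee_fin sqr_ge0.
    - by apply/measurable_EFinP/measurable_normc_sqr; exact: (cmeasurable_pair2 x mX).
    - by move=> y _; rewrite mule_ge0// lee_fin sqr_ge0.
    - apply: emeasurable_funM => //.
      by apply/measurable_EFinP/measurable_normc_sqr/L2cmeas.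
  have /L2P[_ gi] := L2valP g.
  have := integrableD measurableT integrable_covdiag
    (integrableZl measurableT (sqn (@dotL2 _ _ _ P) Y) gi).
  move=> /integrableP[_]; apply: le_lt_trans.
  apply: (@le_trans _ _ (\int[mu]_x \int[P]_y (G (x, y))%:E)%E); last first.
    rewrite le_eqVlt; apply/orP; left; apply/eqP; apply: eq_integral => x _.
    rewrite GE /= ger0_norm//.
    by rewrite addr_ge0 ?covdiag_ge0// mulr_ge0 ?sqr_ge0// (sqn_ge0 (dotL2_semi_inner P)).
  have mn : measurable_fun setT (fun p : T * Omega => (normc (F (p.2, p.1)))%:E).
    by apply/measurable_EFinP/measurable_normc.
  have n0 (p : T * Omega) : (0 <= (normc (F (p.2, p.1)))%:E)%E by rewrite lee_fin normc_ge0.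
  apply: ge0_le_integral => //.
  - by move=> x _; apply: integral_ge0 => y _; rewrite lee_fin normc_ge0.
  - exact: (measurable_fun_fubini_tonelli_F _ mn n0).
  - exact: (measurable_fun_fubini_tonelli_F _ mG G0).
  - move=> x _; apply: ge0_le_integral => //.
    + by move=> y _; rewrite lee_fin normc_ge0.
    + exact: (measurableT_comp mn (pair1_measurable x)).
    + exact: (measurableT_comp mG (pair1_measurable x)).
    + move=> y _; rewrite lee_fin /G /F /= !ComplexField.Normc.normcM normc_conjc.
      have := sqr_ge0 (normc (X x y) - normc (Y y) * normc (g x)).
      have := normc_ge0 (X x y); have := normc_ge0 (Y y); have := normc_ge0 (g x).
      by nra.
have [i1 e1] := fubini_cintegral mF' Ffin.
have eF : (fun x => cintegral P (fun y => F ((x, y).2, (x, y).1))) =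
    (fun t => dotL2 Y (Xval t) * g t) by apply/funext => t; exact: FT.
split; first by rewrite -eF.
rewrite -eF e1 /dotL2 /L2dot.
(* Conjugation and the factor Y(w) pass through the path integral when the integrand is integrable,
   which holds almost surely. *)
apply: eq_cintegral_ae.
- by apply: cmeasurableM; [exact: L2cmeas|apply: cmeasurable_conj; exact: L2cmeas].
- exact: (measurable_cintegral_l mu mF).
- apply: filterS (path_cintegrable (L2valP g)) => w hw.
  (* Inside a product, [x ^*] is parsed as [Num.conj x], only convertible to
     [conjc x]. *)
  change (Y w * conjc (cintegral mu (fun s => X s w * conjc (g s))) =
    cintegral mu (fun t => F (w, t))).
  rewrite -cintegral_conj// -cintegralZ; last exact: cintegrable_conj.
  by congr cintegral; apply/funext => t; rewrite /F /= rmorphM /= conjcK mulrA.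
Qed.

End L2_process.

Section covariance_like.
Context {R : realType} {d} {T : measurableType d} (mu : {measure set T -> \bar R}).

Definition kop (K : T -> T -> R[i]) (g : T -> R[i]) (x : T) : R[i] :=
  cintegral mu (fun y => K x y * g y).

Definition kdiag (K : T -> T -> R[i]) (x : T) : R := complex.Re (K x x).

(* The properties of the covariance kernel of a process from which the spectral
   decomposition is derived; they survive deflation because the deflated kernel
   is the covariance kernel of the remainder of the expansion. *)
Record covariance_like (K : T -> T -> R[i]) : Prop := CovarianceLike {
  kdiag_ge0 : forall x, 0 <= kdiag K x;
  kdiag_integrable : mu.-integrable setT (EFin \o kdiag K);
  section_L2 : forall x, L2 mu (fun y => K y x);
  kernelC : forall x y, K y x = conjc (K x y);
  kernel_CS : forall x y, normc (K x y) ^+ 2 <= kdiag K x * kdiag K y;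
  kop_L2 : forall g, L2 mu g -> L2 mu (kop K g);
  kop_sym : forall f g, L2 mu f -> L2 mu g ->
    L2dot mu (kop K f) g = L2dot mu f (kop K g);
  kop_ge0 : forall g, L2 mu g -> 0 <= complex.Re (L2dot mu (kop K g) g);
  kop_CS : forall g x, L2 mu g ->
    normc (kop K g x) ^+ 2 <= kdiag K x * complex.Re (L2dot mu (kop K g) g) }.

End covariance_like.

Section process_kernel.
Context {R : realType} {d d'} {T : measurableType d} {Omega : measurableType d'}.
Variables (mu : {sigma_finite_measure set T -> \bar R}) (P : probability Omega R).
Variable X : T -> Omega -> R[i].
Hypothesis hX : L2_process mu P X.

Local Notation V := (Xval hX).
Local Notation K := (fun x y => L2dot P (X x) (X y)).
Let dP := dotL2_semi_inner P.
Let dmu := dotL2_semi_inner mu.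

Lemma kop_dot (g : L2fun mu) x : kop mu K g x = dotL2 (V x) (Lcoef hX g).
Proof. by rewrite (fubini_coef hX (V x) g).2. Qed.

Lemma kop_integrable (g : L2fun mu) x : cintegrable mu (fun y => K x y * g y).
Proof. exact: (fubini_coef hX (V x) g).1. Qed.

(** [coef] is conjugate-linear in its argument, which is why f and g trade places. Being a Gram
    form, the left-hand side yields symmetry and positivity of the operator. *)
Lemma dot_Lcoef (f g : L2fun mu) :
  dotL2 (Lcoef hX f) (Lcoef hX g) = L2dot mu g (kop mu K f).
Proof.
rewrite (fubini_coef hX _ g).2 /L2dot; congr cintegral; apply/funext => t.
by rewrite kop_dot (semi_innerC dP) mulrC.
Qed.

Lemma sqn_Lcoef (g : L2fun mu) :
  sqn (@dotL2 _ _ _ P) (Lcoef hX g) = complex.Re (L2dot mu g (kop mu K g)).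
Proof. by rewrite /sqn dot_Lcoef. Qed.

Lemma process_covariance_like : covariance_like mu K.
Proof.
have mX := process_measurable hX.
have K0 x : 0 <= kdiag K x by exact: (covdiag_ge0 hX x).
have iK : mu.-integrable setT (EFin \o kdiag K) by exact: (integrable_covdiag hX).
have mdot (f : Omega -> R[i]) : cmeasurable f ->
    cmeasurable (fun x => cintegral P (fun w => X x w * conjc (f w))).
  move=> mf; apply: (@measurable_cintegral_l _ _ _ _ _ P
    (fun p : T * Omega => X p.1 p.2 * conjc (f p.2))).
  apply: cmeasurableM; first exact: (cmeasurable_swap mX).
  by apply: cmeasurable_conj; apply: (cmeasurable_comp _ mf); exact: measurable_snd.
have KCS x y : normc (K x y) ^+ 2 <= kdiag K x * kdiag K y.
  exact: (Cauchy_Schwarz dP (V x) (V y)).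
have opCS (g : L2fun mu) x : normc (kop mu K g x) ^+ 2 <=
    kdiag K x * complex.Re (L2dot mu g (kop mu K g)).
  by rewrite -sqn_Lcoef kop_dot; exact: (Cauchy_Schwarz dP).
have opL2 g : L2 mu g -> L2 mu (kop mu K g).
  move=> lg; pose G := toL2 lg.
  have h := integrableZl measurableT (complex.Re (L2dot mu g (kop mu K g))) iK.
  apply: (le_L2 _ h); last by move=> x; rewrite /= mulrC; exact: (opCS G).
  (* Measurability is read off the factored form, an integral over [Omega] of a jointly measurable
     function. *)
  have -> : kop mu K g = fun x => cintegral P (fun w => X x w * conjc (coef mu X g w)).
    by apply/funext => x; exact: (kop_dot G x).
  by apply: mdot; exact: (coef_measurable hX (L2cmeas G)).
have opsym f g : L2 mu f -> L2 mu g ->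
    L2dot mu (kop mu K f) g = L2dot mu f (kop mu K g).
  move=> lf lg; rewrite -[RHS](dot_Lcoef (toL2 lg) (toL2 lf)).
  rewrite (semi_innerC dP) dot_Lcoef.
  rewrite -[L2dot mu _ _ in RHS]/(dotL2 (toL2 lg) (toL2 (opL2 _ lf))).
  by rewrite -(semi_innerC dmu).
split=> //.
- move=> x; have h := integrableZl measurableT (kdiag K x) iK.
  apply: (le_L2 _ h); last by move=> y; rewrite /= mulrC; exact: KCS.
  exact: (mdot _ (L2cmeas (V x))).
- by move=> x y; exact: (semi_innerC dP (V x) (V y)).
- by move=> g lg; rewrite opsym// -(sqn_Lcoef (toL2 lg)) (sqn_ge0 dP).
- by move=> g x lg; rewrite opsym//; exact: (opCS (toL2 lg)).
Qed.

End process_kernel.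

(** * The top eigenpair *)

Lemma cvg0_le (R : realType) (u v : nat -> R) (c : R) :
  (forall n, 0 <= u n <= c * v n) -> v n @[n --> \oo] --> 0 ->
  u n @[n --> \oo] --> 0.
Proof.
move=> uv v0; apply: (@squeeze_cvgr _ _ _ _ (fun=> 0) (fun n => c * v n)).
- exact: nearW.
- exact: cvg_cst.
- by rewrite -[X in _ --> X](mulr0 c); apply: cvgM => //; exact: cvg_cst.
Qed.

Section top_eigenpair.
Context {R : realType} {d} {T : measurableType d} (mu : {measure set T -> \bar R}).
Variable K : T -> T -> R[i].
Hypothesis hK : covariance_like mu K.

Local Notation dot := (@dotL2 R d T mu).
Local Notation sq := (sqn dot).
Let dP := dotL2_semi_inner mu.
Implicit Types u v : L2fun mu.

Definition Ksec x : L2fun mu := toL2 (section_L2 hK x).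

Definition Kop u : L2fun mu := toL2 (kop_L2 hK (L2valP u)).

Definition ktrace : R := \int[mu]_x kdiag K x.

(** Reproducing property: point evaluations of [Kop u] are scalar products, hence controlled by
    norms and blind to null vectors. *)
Lemma KopE u x : Kop u x = dot u (Ksec x).
Proof.
rewrite /dotL2 /L2dot; congr cintegral; apply/funext => y.
by rewrite mulrC (kernelC hK).
Qed.

Lemma Kop_null u x : sq u = 0 -> Kop u x = 0.
Proof. by move=> u0; rewrite KopE (dot_null_l dP). Qed.

Lemma KopD u v : Kop (u + v) = Kop u + Kop v.
Proof. by apply: eq_L2fun => x; rewrite L2valD !KopE (semi_innerD dP). Qed.

Lemma KopZ a u : Kop (a *: u) = a *: Kop u.
Proof. by apply: eq_L2fun => x; rewrite L2valZ !KopE (semi_innerZ dP). Qed.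

Lemma Kop_sym u v : dot (Kop u) v = dot u (Kop v).
Proof. exact: (kop_sym hK (L2valP u) (L2valP v)). Qed.

Lemma Kop_ge0 u : 0 <= complex.Re (dot (Kop u) u).
Proof. exact: (kop_ge0 hK (L2valP u)). Qed.

Lemma ktrace_ge0 : 0 <= ktrace.
Proof. by apply: Rintegral_ge0 => x _; exact: (kdiag_ge0 hK). Qed.

Lemma sqn_le_ktrace u (c : R) : 0 <= c ->
  (forall x, normc (u x) ^+ 2 <= c * kdiag K x) -> sq u <= c * ktrace.
Proof.
move=> c0 uc; rewrite -lee_fin -sqnorm2E EFinM /ktrace.
have iK := kdiag_integrable hK.
rewrite fineK; last exact: integrable_fin_num.
rewrite -ge0_integralZl//.
- apply: ge0_le_integral => //.
  + by move=> x _; rewrite lee_fin sqr_ge0.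
  + exact/measurable_EFinP/measurable_normc_sqr/L2cmeas.
  + apply: emeasurable_funM => //; exact: measurable_int iK.
  + by move=> x _; rewrite -EFinM lee_fin.
- exact: measurable_int iK.
- by move=> x _; rewrite lee_fin (kdiag_ge0 hK).
Qed.

Lemma sqn_Ksec x : sq (Ksec x) <= kdiag K x * ktrace.
Proof.
apply: sqn_le_ktrace; first exact: (kdiag_ge0 hK).
by move=> y; rewrite mulrC; exact: (kernel_CS hK).
Qed.

(** A crude bound, which makes the supremum defining [opnorm] finite. *)
Lemma Kop_le_ktrace u : complex.Re (dot (Kop u) u) <= ktrace * sq u.
Proof.
have u0 := sqn_ge0 dP u; have t0 := ktrace_ge0.
have h : sq (Kop u) <= (sq u * ktrace) * ktrace.
  apply: sqn_le_ktrace; first by rewrite mulr_ge0.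
  move=> x; rewrite KopE; apply: le_trans (Cauchy_Schwarz dP _ _) _.
  by rewrite -mulrA ler_wpM2l// mulrC sqn_Ksec.
rewrite -(@ler_pXn2r _ 2) ?nnegrE ?Kop_ge0 ?mulr_ge0//.
apply: (@le_trans _ _ (normc (dot (Kop u) u) ^+ 2)).
  by rewrite normc_sqr lerDl sqr_ge0.
apply: le_trans (Cauchy_Schwarz dP _ _) _.
by have := ler_wpM2r u0 h; rewrite exprMn; lra.
Qed.

Let E := [set r : R | exists2 u, sq u <= 1 & r = complex.Re (dot (Kop u) u)].

Definition opnorm : R := sup E.

Let E_has_sup : has_sup E.
Proof.
split.
  by exists (complex.Re (dot (Kop 0) 0)); exists 0 => //; rewrite (sqn0 dP) ler01.
exists ktrace => _ [u u1 ->]; apply: le_trans (Kop_le_ktrace u) _.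
by rewrite ler_piMr// ktrace_ge0.
Qed.

Lemma opnorm_ge0 : 0 <= opnorm.
Proof.
apply: (@le_trans _ _ (complex.Re (dot (Kop 0) 0))); first exact: Kop_ge0.
by apply: ub_le_sup; [exact: E_has_sup.2|exists 0 => //; rewrite (sqn0 dP) ler01].
Qed.

Lemma Kop_le_opnorm u : complex.Re (dot (Kop u) u) <= opnorm * sq u.
Proof.
have [u0|u0] := eqVneq (sq u) 0.
  by apply: le_trans (Kop_le_ktrace u) _; rewrite u0 !mulr0.
have sp : 0 < sq u by rewrite lt_def u0 (sqn_ge0 dP).
pose c := (Num.sqrt (sq u))^-1.
have c0 : 0 <= c by rewrite invr_ge0 sqrtr_ge0.
have c2 : c ^+ 2 = (sq u)^-1 by rewrite exprVn sqr_sqrtr// ltW.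
have : complex.Re (dot (Kop (c%:C *: u)) (c%:C *: u)) <= opnorm.
  apply: ub_le_sup; [exact: E_has_sup.2|exists (c%:C *: u) => //].
  by rewrite (sqnZ dP) normc_real// c2 mulVf.
rewrite KopZ (semi_innerZ dP) (dotZr dP) mulrA mulc_conjc ReRM normc_real// c2.
by rewrite mulrC ler_pdivrMr.
Qed.

Lemma opnorm_approx (e : R) : 0 < e ->
  exists2 u, sq u <= 1 & opnorm - e < complex.Re (dot (Kop u) u).
Proof.
by move=> e0; have [_ [u u1 ->] h] := sup_adherent e0 E_has_sup; exists u.
Qed.

(** At u = K(., x) the operator takes the value ||u||^2 at x, so [kop_CS] reads ||u||^4 <= K(x, x)
    <T u, u>, and the form is at most [opnorm] times ||u||^2. Applied to deflated kernels, this
    gives the estimate by a_J that drives the pointwise convergence. *)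
Lemma sqn_Ksec_opnorm x : sq (Ksec x) <= opnorm * kdiag K x.
Proof.
have s0 := sqn_ge0 dP (Ksec x).
have := kop_CS hK x (section_L2 hK x).
rewrite -[kop mu K _ x]/(Kop (Ksec x) x) KopE (dotvv dP) normc_real//.
rewrite -[L2dot _ _ _]/(dot (Kop (Ksec x)) (Ksec x)) => h.
have := le_trans h (ler_wpM2l (kdiag_ge0 hK x) (Kop_le_opnorm (Ksec x))).
have [->|n0] := eqVneq (sq (Ksec x)) 0.
  by rewrite mulr_ge0// ?opnorm_ge0// (kdiag_ge0 hK).
have sp : 0 < sq (Ksec x) by rewrite lt_def n0 s0.
by move=> h1; rewrite -(ler_pM2l sp) -expr2; apply: le_trans h1 _; rewrite mulrCA mulrA mulrC.
Qed.

Section power_iteration.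
Hypothesis M0 : 0 < opnorm.
Local Notation M := opnorm.
Let U u := (M^-1)%:C *: Kop u.

Let MV0 : 0 <= M^-1. Proof. by rewrite invr_ge0 ltW. Qed.

Let UB u v : U (u - v) = U u - U v.
Proof. by rewrite /U KopD -scaleN1r KopZ scaleN1r scalerBr. Qed.

Let Usym u v : dot (U u) v = dot u (U v).
Proof.
by rewrite /U (semi_innerZ dP) (dotZr dP) Kop_sym; congr (_ * _); exact/esym/conjc_real.
Qed.

Let ReU u v : complex.Re (dot (U u) v) = M^-1 * complex.Re (dot (Kop u) v).
Proof. by rewrite /U (semi_innerZ dP) ReRM. Qed.

Let Upos u : 0 <= complex.Re (dot (U u) u).
Proof. by rewrite ReU mulr_ge0// Kop_ge0. Qed.

Let U1 u : complex.Re (dot (U u) u) <= sq u.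
Proof. by rewrite ReU mulrC ler_pdivrMr// mulrC Kop_le_opnorm. Qed.

Let U2 u : sq (U u) <= complex.Re (dot (U u) u).
Proof.
rewrite ReU (sqnZ dP) normc_real// expr2 -mulrA ler_wpM2l//.
rewrite mulrC ler_pdivrMr// mulrC.
exact: (sqn_operator_le dP KopD KopZ Kop_sym Kop_ge0 Kop_le_opnorm).
Qed.

Let U_le u : sq (U u) <= sq u. Proof. exact: le_trans (U2 u) (U1 u). Qed.

Let iter_le n u : sq (iter n U u) <= sq u.
Proof. by elim: n => //= n IH; exact: le_trans (U_le _) IH. Qed.

Let UE u x : U u x = (M^-1)%:C * dot u (Ksec x).
Proof. by rewrite -KopE. Qed.

Lemma nonvanishing_section : exists y, ~ (sq (iter n U (Ksec y)) @[n --> \oo] --> 0).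
Proof.
apply: contrapT => /forallNP h.
have {}h y : sq (iter n U (Ksec y)) @[n --> \oo] --> 0 by exact: contrapT (h y).
have MV0' : 0 < M^-1 by rewrite invr_gt0.
(* Chosen so that (2n + 3) [del n] = 1/2: the moment of order 2n + 2 loses at most (2n + 2) [del n]
   from a squared norm above 1 - [del n]. *)
pose del n : R := (2 * (n.+1.*2.+1)%:R)^-1.
have del0 n : 0 < del n by rewrite invr_gt0 mulr_gt0// ltr0n.
have /choice [u hu] n : exists u, sq u <= 1 /\ 1 - del n < complex.Re (dot (U u) u).
  have [|u u1 hu] := @opnorm_approx (M * del n); first by rewrite mulr_gt0.
  exists u; split => //; rewrite ReU mulrC ltr_pdivlMr//.
  by rewrite mulrBl mul1r mulrC.
(* One factor [U] is spent on evaluating at a point; the other n move by symmetry onto the section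
   at x, so the assumed decay makes [g n x] tend to 0. *)
pose g n := iter n.+1 U (u n).
have gE n x : g n x = (M^-1)%:C * dot (u n) (iter n U (Ksec x)).
  by rewrite /g iterS UE (iter_sym Usym).
have g_half n : 2^-1 <= sq (g n).
  rewrite /g (sqn_iter Usym).
  apply: le_trans (moment_lower dP UB Usym Upos _ _).
  have [h1 h2] := hu n; have h3 := U1 (u n).
  rewrite -[iter 1 U (u n)]/(U (u n)).
  have nn : (0 : R) <= n.+1.*2%:R by rewrite ler0n.
  have h4 : n.+1.*2%:R * (sq (u n) - complex.Re (dot (U (u n)) (u n))) <= n.+1.*2%:R * del n.
    by apply: ler_wpM2l => //; lra.
  have h5 : n.+1.*2%:R * del n + del n = 2^-1.
    rewrite /del -[n.+1.*2.+1%:R]natr1; field.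
    by apply: lt0r_neq0; lra.
  lra.
have gi : mu.-integrable setT (EFin \o (fun x => M^-1 ^+ 2 * ktrace * kdiag K x)).
  by have := integrableZl measurableT (M^-1 ^+ 2 * ktrace) (kdiag_integrable hK).
have g_le n x : normc (g n x) ^+ 2 <= M^-1 ^+ 2 * sq (iter n U (Ksec x)).
  rewrite gE ComplexField.Normc.normcM exprMn normc_real// ler_wpM2l ?exprn_ge0//.
  apply: le_trans (Cauchy_Schwarz dP _ _) _.
  by rewrite ler_piMl ?(sqn_ge0 dP)// (hu n).1.
have g_dom n x : normc (g n x) ^+ 2 <= M^-1 ^+ 2 * ktrace * kdiag K x.
  apply: le_trans (g_le n x) _; rewrite -mulrA ler_wpM2l ?exprn_ge0// mulrC.
  exact: le_trans (iter_le _ _) (sqn_Ksec x).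
have g_cvg x : normc (g n x - 0) @[n --> \oo] --> 0.
  apply/(cvg0_sqr_normc (fun n => g n x)).
  by apply: (cvg0_le _ (h x)) => n; rewrite sqr_ge0 subr0; exact: g_le.
have [v v0 hv] := @L2_dominated _ _ _ mu g (fun=> 0) _ gi g_dom g_cvg.
have vz : v = 0 by apply: eq_L2fun.
move/cvgrPdist_lt : hv => /(_ 2^-1); rewrite invr_gt0 ltr0n => /(_ isT) [n _ hn].
have := hn n (leqnn n); rewrite /= vz subr0 sub0r normrN ger0_norm ?(sqn_ge0 dP)//.
by rewrite ltNge g_half.
Qed.

Lemma eigenvector_exists :
  exists2 z : L2fun mu, sq z = 1 & forall x, Kop z x = M%:C * z x.
Proof.
have [y hy] := nonvanishing_section.
have [v hv] := @L2_complete _ _ _ mu (fun n => iter n U (Ksec y))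
  (iter_cauchy dP Usym Upos U1 U2 (Ksec y)).
(* [U] does not increase norms, so the limit of the iterates is fixed, up to a null vector. *)
have Uv : sq (U v - v) = 0.
  apply/eqP; rewrite eq_le (sqn_ge0 dP) andbT; apply/ler_addgt0Pr => e e0; rewrite add0r.
  have e4 : 0 < e / 4 by rewrite divr_gt0.
  move/cvgrPdist_lt : hv => /(_ _ e4) [N _ hN].
  have a1 := hN N (leqnn _); have a2 := hN N.+1 (leqnSn _); move: a1 a2 => /=.
  rewrite !sub0r !normrN !ger0_norm ?(sqn_ge0 dP)// => a1 a2.
  have -> : U v - v = (U v - U (iter N U (Ksec y))) + (U (iter N U (Ksec y)) - v).
    by rewrite addrA subrK.
  apply: le_trans (sqnD_le dP _ _) _.
  have := U_le (v - iter N U (Ksec y)); rewrite UB (sqnBC dP v).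
  lra.
have v0 : sq v != 0.
  apply/negP => /eqP v0; apply: hy.
  apply: (cvg0_le _ hv (c := 2)) => n; rewrite (sqn_ge0 dP) /=.
  by have := sqnD_le dP (iter n U (Ksec y) - v) v; rewrite subrK v0; lra.
have q0 : sq (U v) != 0.
  apply/negP => /eqP q0; move: v0; apply/negP; rewrite negbK eq_le (sqn_ge0 dP) andbT.
  by have := sqnD_le dP (v - U v) (U v); rewrite subrK (sqnBC dP v) Uv q0; lra.
(* [U v - v] is null and [Kop] annihilates null vectors at every point, so [U v] is fixed as a
   function, whereas [v] is known to be fixed only up to a null vector. *)
have UUv : U (U v) = U v.
  apply: eq_L2fun => x; apply/eqP; rewrite -subr_eq0 -L2valB -UB.
  by rewrite /U L2valZ Kop_null ?mulr0.
have KU : Kop (U v) = M%:C *: U v.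
  rewrite -[in RHS]UUv {2}/U scalerA -rmorphM /= divff ?scale1r// gt_eqF//.
exists (normalize dot (U v)); first by rewrite (sqn_normalize dP) q0.
move=> x; rewrite -L2valZ /normalize (negPf q0) KopZ KU.
by rewrite scalerA mulrC -scalerA.
Qed.

End power_iteration.

Lemma top_eigenpair : exists (a : R) (z : L2fun mu),
  [/\ 0 <= a,
      forall x, kop mu K z x = a%:C * z x,
      (a = 0 /\ z = 0) \/ (0 < a /\ sq z = 1),
      forall u, complex.Re (L2dot mu (kop mu K u) u) <= a * sq u
    & forall x, sq (Ksec x) <= a * kdiag K x].
Proof.
have [M0|M0] := eqVneq opnorm 0.
  exists 0, 0; split=> //.
  - by move=> x; rewrite mul0r; exact: (@Kop_null 0 x (sqn0 dP)).
  - by left.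
  - by move=> u; rewrite -M0; exact: Kop_le_opnorm.
  - by move=> x; rewrite -M0; exact: sqn_Ksec_opnorm.
have Mp : 0 < opnorm by rewrite lt_def M0 opnorm_ge0.
have [z z1 hz] := eigenvector_exists Mp.
exists opnorm, z; split=> //; [exact: opnorm_ge0|by right|exact: Kop_le_opnorm|].
exact: sqn_Ksec_opnorm.
Qed.

End top_eigenpair.

(** * Deflation *)

Lemma conjcRM (R : realType) (a : R) (x : R[i]) : conjc (a%:C * x) = a%:C * conjc x.
Proof.
by apply: complex_ext; rewrite ?Re_conjc ?Im_conjc ?ReRM ?ImRM ?Re_conjc ?Im_conjc ?mulrN.
Qed.

Section remainder.
Context {R : realType} {d d'} {T : measurableType d} {Omega : measurableType d'}.
Variables (mu : {sigma_finite_measure set T -> \bar R}) (P : probability Omega R).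
Variable X : T -> Omega -> R[i].
Hypothesis hX : L2_process mu P X.
Variables (z : nat -> L2fun mu) (a : nat -> R) (J : nat).

Local Notation V := (Xval hX).
Local Notation K := (fun x y => L2dot P (X x) (X y)).
Local Notation dot := (@dotL2 R d T mu).
Local Notation dotP := (@dotL2 R d' Omega P).
Let dP := dotL2_semi_inner P.
Let dmu := dotL2_semi_inner mu.

Hypothesis z_eigen : forall j, (j < J)%N -> forall x, kop mu K (z j) x = (a j)%:C * z j x.
Hypothesis z_orth : forall j k, (j < J)%N -> (k < J)%N -> a j != 0 -> a k != 0 ->
  dot (z j) (z k) = (j == k)%:R.

Definition remainder (s : T) (w : Omega) : R[i] :=
  X s w - \sum_(j < J) coef mu X (z j) w * z j s.

Definition mercer_remainder (x y : T) : R[i] :=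
  L2dot P (X x) (X y) - \sum_(j < J) (a j)%:C * z j x * conjc (z j y).

Lemma dot_process_coef x j : (j < J)%N ->
  dotP (V x) (Lcoef hX (z j)) = (a j)%:C * z j x.
Proof. by move=> jJ; rewrite -kop_dot z_eigen. Qed.

(** The scalar product equals a_j <z_k, z_j>. Orthonormality is available between nonzero
    eigenvalues; if one eigenvalue is 0, this formula or its conjugate gives 0. *)
Lemma dot_coef j k : (j < J)%N -> (k < J)%N ->
  dotP (Lcoef hX (z j)) (Lcoef hX (z k)) = (j == k)%:R * (a j)%:C.
Proof.
have E i l : (i < J)%N ->
    dotP (Lcoef hX (z i)) (Lcoef hX (z l)) = (a i)%:C * dot (z l) (z i).
  move=> iJ; rewrite dot_Lcoef.
  have -> : (a i)%:C * dot (z l) (z i) = dot (z l) ((a i)%:C *: z i).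
    by rewrite (dotZr dmu); congr (_ * _); exact/esym/conjc_real.
  by congr (L2dot mu _ _); apply/funext => x; rewrite z_eigen.
move=> jJ kJ; have [aj0|aj0] := eqVneq (a j) 0.
  by rewrite E// aj0 mul0r mulr0.
have [ak0|ak0] := eqVneq (a k) 0.
  rewrite (semi_innerC dP) E// ak0 mul0r conjc0.
  have [jk|_] := eqVneq j k; last by rewrite mul0r.
  by move: aj0; rewrite jk ak0 eqxx.
by rewrite E// z_orth// eq_sym mulrC.
Qed.

Definition Lremainder s : L2fun P := V s - \sum_(j < J) z j s *: Lcoef hX (z j).

Lemma LremainderE s w : Lremainder s w = remainder s w.
Proof.
rewrite /Lremainder L2valB L2val_sum; congr (_ - _).
by apply: eq_bigr => j _; rewrite L2valZ mulrC.
Qed.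

(** The remainder vector is orthogonal to every coefficient already removed, so the subtraction
    contributes in one of the two arguments only. *)
Lemma dot_remainder x y : dotP (Lremainder x) (Lremainder y) = mercer_remainder x y.
Proof.
have E1 (s : T) : \sum_(j < J) dotP (V x) (z j s *: Lcoef hX (z j)) =
    \sum_(j < J) (a j)%:C * z j x * conjc (z j s).
  by apply: eq_bigr => j _; rewrite (dotZr dP) dot_process_coef// mulrC.
have VC j s : (j < J)%N -> dotP (Lcoef hX (z j)) (V s) = (a j)%:C * conjc (z j s).
  by move=> jJ; rewrite (semi_innerC dP (V s)) dot_process_coef//; exact: conjcRM.
have E3 i : (i < J)%N -> dotP (Lcoef hX (z i)) (Lremainder y) = 0.
  move=> iJ; rewrite /Lremainder (dotBr dP) VC// (dot_sumr dP).
  rewrite (bigD1 (Ordinal iJ))//= big1 ?addr0; last first.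
    move=> j ji; rewrite (dotZr dP) dot_coef//.
    by rewrite (_ : (i == j :> nat) = false) ?mul0r ?mulr0//; apply/negbTE; rewrite eq_sym.
  rewrite (dotZr dP) dot_coef// eqxx mul1r.
  by rewrite [X in _ - X]mulrC subrr.
rewrite {1}/Lremainder (dotBl dP) (dot_suml dP) [X in _ - X]big1 ?subr0; last first.
  by move=> i _; rewrite (semi_innerZ dP) E3// mulr0.
by rewrite /Lremainder (dotBr dP) (dot_sumr dP) E1.
Qed.

Lemma sqn_remainder x :
  sqn dotP (Lremainder x) = kdiag mercer_remainder x.
Proof. by rewrite /sqn dot_remainder. Qed.

Lemma kdiag_remainder x :
  kdiag mercer_remainder x = kdiag K x - \sum_(j < J) a j * normc (z j x) ^+ 2.
Proof.
rewrite /kdiag /mercer_remainder cReD cReN Re_sum; congr (_ - _).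
by apply: eq_bigr => j _; rewrite -mulrA mulc_conjc ReRM.
Qed.

Hypothesis a_ge0 : forall j, 0 <= a j.

(** Integrability is inherited because E|X_s|^2 drops at every s by a sum of nonnegative terms a_j
    |z_j(s)|^2. *)
Lemma remainder_process : L2_process mu P remainder.
Proof.
have mX := process_measurable hX.
have mY : cmeasurable (fun p : Omega * T => remainder p.2 p.1).
  apply: cmeasurableD => //; apply: cmeasurableN; apply: cmeasurable_sum => j.
  apply: cmeasurableM.
    apply: (cmeasurable_comp _ (coef_measurable hX (L2cmeas (z j)))).
    exact: measurable_fst.
  by apply: (cmeasurable_comp _ (L2cmeas (z j))); exact: measurable_snd.
have E s : remainder s = Lremainder s by apply/funext => w; rewrite LremainderE.
have L s : L2 P (remainder s) by rewrite E; exact: L2valP.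
split=> //.
apply: le_lt_trans (process_integrable hX); apply: ge0_le_integral => //.
- by move=> s _; apply: integral_ge0 => w _; rewrite lee_fin sqr_ge0.
- apply: (measurable_fun_fubini_tonelli_G (fun p => (normc (remainder p.2 p.1) ^+ 2)%:E)).
    exact/measurable_EFinP/measurable_normc_sqr.
  by move=> p; rewrite lee_fin sqr_ge0.
- apply: (measurable_fun_fubini_tonelli_G (fun p => (normc (X p.2 p.1) ^+ 2)%:E)).
    exact/measurable_EFinP/measurable_normc_sqr.
  by move=> p; rewrite lee_fin sqr_ge0.
- move=> s _; rewrite E sqnorm2E (sqnorm2_process hX) lee_fin sqn_remainder kdiag_remainder.
  rewrite gerBl sumr_ge0// => j _; by rewrite mulr_ge0// sqr_ge0.
Qed.

Lemma remainder_covariance_like : covariance_like mu mercer_remainder.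
Proof.
have -> : mercer_remainder = fun x y => L2dot P (remainder x) (remainder y).
  apply/funext => x; apply/funext => y; rewrite -dot_remainder.
  by congr (L2dot P _ _); apply/funext => w; rewrite LremainderE.
exact: (process_covariance_like remainder_process).
Qed.

Lemma kop_remainder (g : L2fun mu) x :
  kop mu mercer_remainder g x = kop mu K g x - \sum_(j < J) (a j)%:C * z j x * dot g (z j).
Proof.
have i1 := kop_integrable hX g x.
have ij j : cintegrable mu (fun y => (- ((a j)%:C * z j x)) * (g y * conjc (z j y))).
  by apply: cintegrableZ; exact: (dotL2_integrable g (z j)).
have is_ n : cintegrable mu (fun y => \sum_(j < n) (- ((a j)%:C * z j x)) * (g y * conjc (z j y))) /\
    cintegral mu (fun y => \sum_(j < n) (- ((a j)%:C * z j x)) * (g y * conjc (z j y))) =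
    - \sum_(j < n) (a j)%:C * z j x * dot g (z j).
  elim: n => [|n [IH1 IH2]].
    have -> : (fun y => \sum_(j < 0) (- ((a j)%:C * z j x)) * (g y * conjc (z j y))) = fun=> 0.
      by apply/funext => y; rewrite big_ord0.
    rewrite big_ord0 oppr0 /cintegrable /cintegral /Rintegral integral0.
    by split=> //; split; exact: integrable0.
  have -> : (fun y => \sum_(j < n.+1) (- ((a j)%:C * z j x)) * (g y * conjc (z j y))) =
      fun y => \sum_(j < n) (- ((a j)%:C * z j x)) * (g y * conjc (z j y)) +
        (- ((a n)%:C * z n x)) * (g y * conjc (z n y)).
    by apply/funext => y; rewrite big_ord_recr.
  split; first exact: cintegrableD.
  rewrite cintegralD// IH2 cintegralZ ?big_ord_recr /= ?opprD ?mulNr//.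
  exact: (dotL2_integrable g (z n)).
rewrite -(is_ J).2 -cintegralD//; last exact: (is_ J).1.
congr cintegral; apply/funext => y; rewrite /mercer_remainder mulrDl mulNr mulr_suml -sumrN.
by congr (_ + _); apply: eq_bigr => j _; rewrite mulNr; congr (- _); rewrite -!mulrA [g y * _]mulrC.
Qed.

End remainder.

Section eigen_sequence.
Context {R : realType} {d d'} {T : measurableType d} {Omega : measurableType d'}.
Variables (mu : {sigma_finite_measure set T -> \bar R}) (P : probability Omega R).

Local Notation dot := (@dotL2 R d T mu).
Local Notation sq := (sqn dot).
Let dmu := dotL2_semi_inner mu.

Definition is_top_eigenpair (K : T -> T -> R[i]) (a : R) (z : L2fun mu) : Prop :=
  [/\ 0 <= a,
      forall x, kop mu K z x = a%:C * z x,
      (a = 0 /\ z = 0) \/ (0 < a /\ sq z = 1),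
      forall u : L2fun mu, complex.Re (L2dot mu (kop mu K u) u) <= a * sq u
    & forall x, (sqnorm2 mu (fun y => K y x) <= (a * kdiag K x)%:E)%E].

Variable X : T -> Omega -> R[i].
Hypothesis hX : L2_process mu P X.
Local Notation K := (fun x y => L2dot P (X x) (X y)).

Lemma eigen_sequence : exists (z : nat -> L2fun mu) (a : nat -> R), forall J,
  [/\ covariance_like mu (mercer_remainder P X z a J),
      is_top_eigenpair (mercer_remainder P X z a J) (a J) (z J),
      forall x, kop mu K (z J) x = (a J)%:C * z J x
    & forall j, (j < J)%N -> dot (z J) (z j) = 0].
Proof.
(* The choice is total on kernels, arbitrary outside [covariance_like], so that the recursion
   carries no proofs; validity is established afterwards by strong induction. *)
have [top htop] : exists top : (T -> T -> R[i]) -> R * L2fun mu,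
    forall K', covariance_like mu K' -> is_top_eigenpair K' (top K').1 (top K').2.
  suff /choice [top htop] : forall K', exists p : R * L2fun mu,
    covariance_like mu K' -> is_top_eigenpair K' p.1 p.2 by exists top.
  move=> K'; have [hK'|nK'] := pselect (covariance_like mu K'); last first.
    by exists (0, 0) => /nK'.
  have [a [z [h1 h2 h3 h4 h5]]] := top_eigenpair hK'.
  exists (a, z) => _; split=> //= x.
  by have := h5 x; rewrite -lee_fin -sqnorm2E.
pose Rk := fix Rk n : T -> T -> R[i] := if n is m.+1 then
  fun x y => Rk m x y - ((top (Rk m)).1)%:C * (top (Rk m)).2 x * conjc ((top (Rk m)).2 y)
  else K.
pose z n := (top (Rk n)).2; pose a n := (top (Rk n)).1.
have RkE n : Rk n = mercer_remainder P X z a n.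
  apply/funext => x; apply/funext => y; rewrite /mercer_remainder.
  elim: n => [|n IH]; first by rewrite big_ord0 subr0.
  by rewrite big_ord_recr /= opprD addrA -IH.
exists z, a; elim/ltn_ind => J IH.
have z_eigen j : (j < J)%N -> forall x, kop mu K (z j) x = (a j)%:C * z j x.
  by move=> /IH [].
have z_top j : (j < J)%N -> (a j = 0 /\ z j = 0) \/ (0 < a j /\ sq (z j) = 1).
  by move=> /IH [_ []].
have z_orth0 j k : (j < J)%N -> (k < J)%N -> j != k -> dot (z j) (z k) = 0.
  move=> jJ kJ; rewrite neq_ltn => /orP[jk|kj].
    have [_ _ _ h] := IH k kJ.
    by rewrite (semi_innerC dmu) h// conjc0.
  by have [_ _ _ h] := IH j jJ; exact: h.
have z_orth j k : (j < J)%N -> (k < J)%N -> a j != 0 -> a k != 0 ->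
    dot (z j) (z k) = (j == k)%:R.
  move=> jJ kJ aj0 _; have [<-|jk] := eqVneq j k; last exact: z_orth0.
  rewrite (dotvv dmu); have [[aj _]|[_ ->]//] := z_top j jJ.
  by rewrite aj eqxx in aj0.
have a_ge0 j : (j < J)%N -> 0 <= a j by move=> /IH [_ []].
have cK : covariance_like mu (mercer_remainder P X z a J).
  (* Nonnegativity of the eigenvalues is known only below J at this stage of the induction, hence
     the truncation. *)
  pose a' j := if (j < J)%N then a j else 0.
  have -> : mercer_remainder P X z a J = mercer_remainder P X z a' J.
    apply/funext => x; apply/funext => y; rewrite /mercer_remainder; congr (_ - _).
    by apply: eq_bigr => j _; rewrite /a' ltn_ord.
  apply: (remainder_covariance_like hX).
  - by move=> j jJ x; rewrite /a' jJ z_eigen.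
  - by move=> j k jJ kJ; rewrite /a' jJ kJ; exact: z_orth.
  - by move=> j; rewrite /a'; case: ifPn => // jJ; exact: a_ge0.
have topJ : is_top_eigenpair (mercer_remainder P X z a J) (a J) (z J).
  by rewrite -RkE; apply: htop; rewrite RkE.
have [aJ0 zJ_eig zJ_top _ _] := topJ.
have orthJ j : (j < J)%N -> dot (z J) (z j) = 0.
  move=> jJ; have [[_ ->]|[aJ _]] := zJ_top; first by rewrite (dot0l dmu).
  (* The deflated operator annihilates the earlier eigenvectors; as a_J > 0, symmetry then makes
     them orthogonal to [z J]. *)
  have kop0 x : kop mu (mercer_remainder P X z a J) (z j) x = 0.
    rewrite (kop_remainder hX) z_eigen// (bigD1 (Ordinal jJ))//= big1 ?addr0; last first.
      move=> k kj; rewrite z_orth0 ?mulr0// eq_sym.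
      by apply: contraNneq kj => kj; apply/eqP/val_inj.
    have [[-> ->]|[_ s1]] := z_top j jJ; first by rewrite !mul0r subr0.
    by rewrite (dotvv dmu) s1 mulr1 subrr.
  have := kop_sym cK (L2valP (z J)) (L2valP (z j)).
  rewrite (_ : kop mu _ (z j) = (0 : L2fun mu)); last by apply/funext => x; rewrite kop0.
  rewrite [RHS](dot0r dmu (z J)) (_ : kop mu _ (z J) = (a J)%:C *: z J); last first.
    by apply/funext => x; rewrite zJ_eig.
  rewrite [LHS](semi_innerZ dmu) => /eqP; rewrite mulf_eq0 => /orP[/eqP h|/eqP//].
  by move: aJ; rewrite -(complexI h) ltxx.
split=> // x.
(* Orthogonality kills the deflation terms on [z J], which is therefore an eigenvector of the
   original operator. *)
have := zJ_eig x; rewrite (kop_remainder hX) big1 ?subr0// => j _.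
by rewrite orthJ// mulr0.
Qed.

End eigen_sequence.

(** * Continuous covariance *)

Section complex_continuity.
Context {R : realType} {U : topologicalType}.

Lemma cvg_normcP (f : U -> R[i]) (x : U) :
  ((f : U -> R[i]^o) y @[y --> x] --> (f x : R[i]^o)) <->
  (forall e : R, 0 < e -> \forall y \near x, normc (f x - f y) < e).
Proof.
split=> [h e e0|h].
  move/cvgrPdist_lt : h => /(_ e%:C); rewrite ltcR => /(_ e0).
  by apply: filterS => y; rewrite normrE_normc ltcR.
apply/cvgrPdist_lt => e e0.
(* A positive complex number is real for this order, so complex tolerances reduce to real ones. *)
have e1 : e = (complex.Re e)%:C.
  by apply: complex_ext => //=; apply: ger0_Im; exact: ltW.
have : 0 < complex.Re e by move: e0; rewrite e1 ltcR.
move=> /h; apply: filterS => y; rewrite e1.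
by rewrite normrE_normc ltcR.
Qed.

End complex_continuity.

Section eigen_system.
Context {R : realType} {d d'} {S : topMeasurableType d} {Omega : measurableType d'}.
Variables (mu : {sigma_finite_measure set S -> \bar R}) (P : probability Omega R).
Variable X : S -> Omega -> R[i].
Hypothesis hX : L2_process mu P X.
Local Notation V := (Xval hX).
Local Notation K := (fun x y => L2dot P (X x) (X y)).
Local Notation dot := (@dotL2 R d S mu).
Local Notation dotP := (@dotL2 R d' Omega P).
Let dP := dotL2_semi_inner P.
Let dmu := dotL2_semi_inner mu.

Hypothesis cK : continuous ((fun p : S * S => K p.1 p.2) : S * S -> R[i]^o).

(** Mean-square continuity: ||X_x - X_y||^2 = K(x, x) + K(y, y) - 2 Re K(x, y), which tends to 0 by
    continuity of K at (x, x). *)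
Lemma increment_cvg x (e : R) : 0 < e -> \forall y \near x, sqn dotP (V x - V y) < e.
Proof.
move=> e0; have e4 : 0 < e / 4 by rewrite divr_gt0.
have h1 : \forall y \near x, normc (K x x - K y y) < e / 4.
  apply: (cvg_normcP (fun y => K y y) x).1 => //.
  have := @continuous_comp S (S * S)%type (R[i]^o) (fun y => (y, y)) (fun p => K p.1 p.2) x.
  by apply; [apply: cvg_pair; exact: cvg_id|exact: cK].
have h2 : \forall y \near x, normc (K x x - K x y) < e / 4.
  apply: (cvg_normcP (fun y => K x y) x).1 => //.
  have := @continuous_comp S (S * S)%type (R[i]^o) (fun y => (x, y)) (fun p => K p.1 p.2) x.
  by apply; [apply: cvg_pair; [exact: cvg_cst|exact: cvg_id]|exact: cK].
near=> y.
rewrite (sqnB dP).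
have a1 : normc (K x x - K y y) < e / 4 by near: y.
have a2 : normc (K x x - K x y) < e / 4 by near: y.
have b1 := le_lt_trans (normr_Re_le _) a1.
have b2 := le_lt_trans (normr_Re_le _) a2.
move: b1 b2; rewrite !cReD !cReN !ltr_norml => /andP[b1 b1'] /andP[b2 b2'].
rewrite -[sqn dotP (V x)]/(complex.Re (K x x)) -[sqn dotP (V y)]/(complex.Re (K y y)).
rewrite -[dotP (V x) (V y)]/(K x y).
lra.
Unshelve. all: by end_near. Qed.

Let hK : covariance_like mu K := process_covariance_like hX.

(** The increment is the scalar product of g with a difference of sections, whose squared norm is at
    most ||X_x - X_y||^2 times the trace. *)
Lemma kop_continuous (g : L2fun mu) : continuous (kop mu K g : S -> R[i]^o).
Proof.
move=> x; apply/cvg_normcP => e e0.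
have c0 : 0 <= sqn dot g * ktrace mu K.
  by rewrite mulr_ge0 ?(sqn_ge0 dmu)// (ktrace_ge0 hK).
have ep : 0 < e ^+ 2 / (sqn dot g * ktrace mu K + 1) by rewrite divr_gt0 ?exprn_gt0// ltr_wpDl.
apply: filterS (increment_cvg x ep) => y.
rewrite ltr_pdivlMr; last by rewrite ltr_wpDl.
move=> hy; rewrite -(@ltr_pXn2r _ 2) ?nnegrE ?normc_ge0 ?(ltW e0)//.
have -> : kop mu K g x - kop mu K g y = dot g (Ksec hK x - Ksec hK y).
  by rewrite (dotBr dmu) -!KopE.
apply: le_lt_trans (Cauchy_Schwarz dmu _ _) _; apply: le_lt_trans hy.
have s0 := sqn_ge0 dP (V x - V y).
have : sqn dot (Ksec hK x - Ksec hK y) <= sqn dotP (V x - V y) * ktrace mu K.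
  apply: (sqn_le_ktrace hK) => // t.
  change (normc (dotP (V t) (V x) - dotP (V t) (V y)) ^+ 2 <=
    sqn dotP (V x - V y) * sqn dotP (V t)).
  rewrite -(dotBr dP).
  by apply: le_trans (Cauchy_Schwarz dP _ _) _; rewrite mulrC.
move=> /(ler_wpM2l (sqn_ge0 dmu g)) /le_trans; apply.
by rewrite mulrCA ler_wpM2l// lerDl.
Qed.

Variables (z : nat -> L2fun mu) (a : nat -> R).
Hypothesis z_eigen : forall j x, kop mu K (z j) x = (a j)%:C * z j x.
Hypothesis z_orth : forall j k, a j != 0 -> a k != 0 -> dot (z j) (z k) = (j == k)%:R.
Hypothesis a_ge0 : forall j, 0 <= a j.

Local Notation RJ J := (mercer_remainder P X z a J).
Local Notation W := (Lremainder hX z).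

Let z_eigen' J j : (j < J)%N -> forall x, kop mu K (z j) x = (a j)%:C * z j x.
Proof. by move=> _; exact: z_eigen. Qed.
Let z_orth' J j k : (j < J)%N -> (k < J)%N -> a j != 0 -> a k != 0 ->
  dot (z j) (z k) = (j == k)%:R.
Proof. by move=> _ _; exact: z_orth. Qed.

Lemma sqn_remainderE J x : sqn dotP (W J x) = kdiag (RJ J) x.
Proof. by apply: sqn_remainder; [exact: z_eigen'|exact: z_orth']. Qed.

Lemma kdiag_remainderE J x :
  kdiag (RJ J) x = kdiag K x - \sum_(j < J) a j * normc (z j x) ^+ 2.
Proof. exact: kdiag_remainder. Qed.

Lemma kdiag_remainder_ge0 J x : 0 <= kdiag (RJ J) x.
Proof. by rewrite -sqn_remainderE (sqn_ge0 dP). Qed.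

Lemma kdiag_remainder_split J L x : (J <= L)%N ->
  \sum_(J <= j < L) a j * normc (z j x) ^+ 2 = kdiag (RJ J) x - kdiag (RJ L) x.
Proof.
move=> JL; rewrite !kdiag_remainderE.
rewrite -(big_mkord xpredT (fun j => a j * normc (z j x) ^+ 2)).
rewrite -(big_mkord xpredT (fun j => a j * normc (z j x) ^+ 2)).
rewrite [X in _ = _ - (_ - X)](big_cat_nat (leq0n J) JL) /=; ring.
Qed.

Lemma kdiag_remainder_le J L x : (J <= L)%N -> kdiag (RJ L) x <= kdiag (RJ J) x.
Proof.
move=> JL; rewrite -subr_ge0 -kdiag_remainder_split//.
by apply: sumr_ge0 => j _; rewrite mulr_ge0// sqr_ge0.
Qed.

(** Equicontinuity uniform in J, as Dini's argument requires: the deficit is the sum of a_j |z_j(x)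
    - z_j(y)|^2. *)
Lemma remainder_increment_le J x y : sqn dotP (W J x - W J y) <= sqn dotP (V x - V y).
Proof.
rewrite (sqnB dP (W J x) (W J y)) (sqnB dP (V x) (V y)) !sqn_remainderE !kdiag_remainderE.
rewrite (dot_remainder hX (@z_eigen' J) (@z_orth' J)) /mercer_remainder.
rewrite cReD cReN Re_sum.
rewrite -[sqn dotP (V x)]/(kdiag K x) -[sqn dotP (V y)]/(kdiag K y).
rewrite -[dotP (V x) (V y)]/(K x y).
have : 0 <= \sum_(j < J) a j * normc (z j x - z j y) ^+ 2.
  by apply: sumr_ge0 => j _; rewrite mulr_ge0// sqr_ge0.
have -> : \sum_(j < J) a j * normc (z j x - z j y) ^+ 2 =
   \sum_(j < J) a j * normc (z j x) ^+ 2 + \sum_(j < J) a j * normc (z j y) ^+ 2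
   - 2 * \sum_(j < J) complex.Re ((a j)%:C * z j x * conjc (z j y)).
  rewrite mulr_sumr -sumrN -!big_split /=; apply: eq_bigr => j _.
  rewrite -mulrA ReRM !normc_sqr cReM Re_conjc Im_conjc !cReD !cReN !cImD !cImN; ring.
lra.
Qed.

Lemma kdiag_remainder_near J x y :
  kdiag (RJ J) y <= 2 * kdiag (RJ J) x + 2 * sqn dotP (V x - V y).
Proof.
rewrite -!sqn_remainderE.
have := sqnD_le dP (W J y - W J x) (W J x); rewrite subrK => /le_trans; apply.
rewrite addrC lerD// ler_wpM2l// (sqnBC dP (W J y) (W J x)).
exact: remainder_increment_le.
Qed.

Lemma kernel_remainder_CS J x y :
  normc (RJ J x y) ^+ 2 <= kdiag (RJ J) x * kdiag (RJ J) y.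
Proof.
rewrite -(dot_remainder hX (@z_eigen' J) (@z_orth' J)) -!sqn_remainderE.
exact: (Cauchy_Schwarz dP).
Qed.

(** z_j is the image of z_j / a_j, and images under the operator are continuous. *)
Lemma eigenfunction_continuous j : a j != 0 -> continuous (z j : S -> R[i]^o).
Proof.
move=> aj0; have -> : (z j : S -> R[i]) = kop mu K (((a j)^-1)%:C *: z j).
  apply/funext => x; rewrite -[RHS]/(Kop hK (((a j)^-1)%:C *: z j) x) KopZ L2valZ.
  by rewrite -[Kop hK (z j) x]/(kop mu K (z j) x) z_eigen mulrA -rmorphM /= mulVf ?mul1r.
exact: kop_continuous.
Qed.

Hypothesis kdiag_cvg : forall x, kdiag (RJ J) x @[J --> \oo] --> 0.

(* Dini's argument: the diagonals decrease to 0. *)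
Lemma kdiag_remainder_unif (C : set S) : compact C -> forall e : R, 0 < e ->
  \forall J \near \oo, forall x, C x -> kdiag (RJ J) x < e.
Proof.
move=> /compact_near_coveringP cC e e0.
apply: (cC nat \oo (fun J x => kdiag (RJ J) x < e)) => x Cx.
have e4 : 0 < e / 4 by rewrite divr_gt0.
have /cvgrPdist_lt /(_ _ e4) [N _ hN] := kdiag_cvg x.
have hx : kdiag (RJ N) x < e / 4.
  have := hN N (leqnn N); rewrite /= sub0r normrN ger0_norm//.
  exact: kdiag_remainder_ge0.
exists ([set y | sqn dotP (V x - V y) < e / 4], [set J | (N <= J)%N]).
  by split=> /=; [exact: increment_cvg|exists N].
move=> [y J] /= [hy NJ].
apply: le_lt_trans (kdiag_remainder_le y NJ) _.
by have := kdiag_remainder_near N x y; lra.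
Qed.

End eigen_system.

(** * Convergence of the kernel and process expansions *)

Section expansion.
Context {R : realType} {d d'} {S : topMeasurableType d} {Omega : measurableType d'}.
Variables (mu : {sigma_finite_measure set S -> \bar R}) (P : probability Omega R).
Variable X : S -> Omega -> R[i].
Hypothesis hX : L2_process mu P X.
Local Notation V := (Xval hX).
Local Notation K := (fun x y => L2dot P (X x) (X y)).
Local Notation dot := (@dotL2 R d S mu).
Local Notation dotP := (@dotL2 R d' Omega P).
Let dP := dotL2_semi_inner P.

Variables (z : nat -> L2fun mu) (a : nat -> R).
Hypothesis z_eigen : forall j x, kop mu K (z j) x = (a j)%:C * z j x.
Hypothesis z_orth : forall j k, a j != 0 -> a k != 0 -> dot (z j) (z k) = (j == k)%:R.
Hypothesis a_ge0 : forall j, 0 <= a j.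

Local Notation RJ J := (mercer_remainder P X z a J).
Local Notation W := (Lremainder hX z).

(** The inequality 2 |z_j(x)| |z_j(y)| <= |z_j(x)|^2 + |z_j(y)|^2 reduces absolute convergence to
    the diagonal, where the sums telescope. *)
Lemma mercer_tail_le J n x y :
  \sum_(J <= j < n) normc ((a j)%:C * z j x * conjc (z j y)) <=
    (kdiag (RJ J) x + kdiag (RJ J) y) / 2.
Proof.
have k0 L t : 0 <= kdiag (RJ L) t by exact: (kdiag_remainder_ge0 hX z_eigen z_orth).
have [nJ|Jn] := leqP n J.
  by rewrite big_geq// divr_ge0// addr_ge0.
apply: (@le_trans _ _ ((\sum_(J <= j < n) a j * normc (z j x) ^+ 2 +
    \sum_(J <= j < n) a j * normc (z j y) ^+ 2) / 2)); last first.
  rewrite !(kdiag_remainder_split P X z a _ (ltnW Jn)).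
  by rewrite ler_pM2r ?invr_gt0// lerD// gerBl.
rewrite -big_split mulr_suml; apply: ler_sum => j _ /=.
rewrite !ComplexField.Normc.normcM normc_conjc normc_real//.
rewrite -mulrDr -!mulrA ler_wpM2l//.
by have := sqr_ge0 (normc (z j x) - normc (z j y)); lra.
Qed.

Lemma process_tail_le J n s :
  \sum_(J <= j < n) a j * normc (z j s) ^+ 2 <= kdiag (RJ J) s.
Proof.
have k0 L t : 0 <= kdiag (RJ L) t by exact: (kdiag_remainder_ge0 hX z_eigen z_orth).
have [nJ|Jn] := leqP n J; first by rewrite big_geq.
by rewrite (kdiag_remainder_split P X z a _ (ltnW Jn)) gerBl.
Qed.

Lemma sqnorm2_remainder J s : sqnorm2 P (remainder X z J s) = (kdiag (RJ J) s)%:E.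
Proof.
have -> : remainder X z J s = W J s by apply/funext => w; rewrite LremainderE.
by rewrite sqnorm2E (sqn_remainderE hX z_eigen z_orth).
Qed.

Lemma coef_orthogonal j k :
  dotP (Lcoef hX (z j)) (Lcoef hX (z k)) = (j == k)%:R * (a j)%:C.
Proof.
apply: (@dot_coef _ _ _ _ _ _ _ _ hX z a (maxn j k).+1) => //.
- by move=> i l _ _; exact: z_orth.
- by rewrite ltnS leq_maxl.
- by rewrite ltnS leq_maxr.
Qed.

Lemma sqn_coef j : sqn dotP (Lcoef hX (z j)) = a j.
Proof. by rewrite /sqn coef_orthogonal eqxx mul1r. Qed.

Lemma sqnorm2_term j s : sqnorm2 P (fun w => coef mu X (z j) w * z j s) =
  (a j * normc (z j s) ^+ 2)%:E.
Proof.
have -> : (fun w => coef mu X (z j) w * z j s) = (z j s *: Lcoef hX (z j) : L2fun P).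
  by apply/funext => w; rewrite L2valZ mulrC.
by rewrite sqnorm2E (sqnZ dP) sqn_coef mulrC.
Qed.

(** Fubini against the constant 1 turns the mean of a coefficient, up to conjugation, into an
    integral of means of [X]. *)
Lemma cexpectation_coef (g : L2fun mu) : (forall s, cexpectation P (X s) = 0) ->
  cexpectation P (coef mu X g) = 0.
Proof.
move=> X0.
have l1 : L2 P (fun _ : Omega => 1).
  split; first exact: cmeasurable_cst.
  rewrite /sqnorm2 ComplexField.Normc.normc1 expr1n integral_cst//.
  by rewrite mul1e (le_lt_trans (probability_le1 P measurableT))// ltry.
have conjE (f : L2fun P) : dotL2 (toL2 l1) f = conjc (cexpectation P f).
  rewrite (semi_innerC dP); congr conjc; congr cintegral.
  by apply/funext => w; rewrite /= rmorph1 mulr1.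
have := (fubini_coef hX (toL2 l1) g).2; rewrite conjE.
have -> : (fun t => dotL2 (toL2 l1) (V t) * g t) = fun=> 0.
  by apply/funext => t; rewrite conjE [X in conjc X](X0 t) conjc0 mul0r.
have -> : cintegral mu (fun=> 0) = 0 by rewrite /cintegral /Rintegral integral0.
by move=> h; rewrite -[LHS]conjcK h conjc0.
Qed.

Hypothesis kdiag_cvg : forall x, kdiag (RJ J) x @[J --> \oo] --> 0.

Lemma remainder_cvg s : sqnorm2 P (remainder X z J s) @[J --> \oo] --> 0%E.
Proof.
under eq_cvg do rewrite sqnorm2_remainder.
by apply: cvg_EFin; [exact: nearW|exact: kdiag_cvg].
Qed.

(** Tonelli rewrites the error as the integral of the deflated diagonals, which tend to 0 and are
    dominated by K(s, s). *)
Lemma integral_remainder_cvg :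
  (\int[P]_w sqnorm2 mu (fun s => remainder X z J s w))%E @[J --> \oo] --> 0%E.
Proof.
have -> : (fun J => \int[P]_w sqnorm2 mu (fun s => remainder X z J s w))%E =
    (fun J => \int[mu]_s (kdiag (RJ J) s)%:E)%E.
  apply/funext => J.
  have hJ : L2_process mu P (remainder X z J).
    apply: (@remainder_process _ _ _ _ _ _ _ _ hX z a J) => //.
    by move=> j k _ _; exact: z_orth.
  rewrite (integral_pathwise_sqnorm2 hJ).
  by apply: eq_integral => s _; rewrite sqnorm2_remainder.
have := @dominated_cvg _ _ _ mu setT measurableT (fun J s => (kdiag (RJ J) s)%:E)
  (fun=> 0%E) (EFin \o kdiag K).
rewrite integral0; apply.
- move=> J; apply: measurable_int.
  apply: (kdiag_integrable (K := RJ J)).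
  apply: (@remainder_covariance_like _ _ _ _ _ _ _ _ hX z a J) => //.
  by move=> j k _ _; exact: z_orth.
- by move=> s _; apply: cvg_EFin; [exact: nearW|exact: kdiag_cvg].
- by [].
- exact: (kdiag_integrable (process_covariance_like hX)).
- move=> J s _ /=; rewrite lee_fin ger0_norm; last exact: (kdiag_remainder_ge0 hX z_eigen z_orth).
  have := kdiag_remainder_le P X z a_ge0 s (leq0n J).
  by rewrite [X in _ <= X]kdiag_remainderE big_ord0 subr0.
Qed.

Hypothesis cK : continuous ((fun p : S * S => K p.1 p.2) : S * S -> R[i]^o).

Lemma remainder_unif (C : set S) : compact C -> forall e : R, 0 < e ->
  \forall J \near \oo, forall s, C s ->
    (sqnorm2 P (remainder X z J s) < e%:E)%E /\
    (\sum_(J <= j <oo) sqnorm2 P (fun w => coef mu X (z j) w * z j s)%R < e%:E)%E.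
Proof.
move=> cC e e0.
have := kdiag_remainder_unif hX cK z_eigen z_orth a_ge0 kdiag_cvg cC e0.
apply: filterS => J hJ s Cs; split; first by rewrite sqnorm2_remainder lte_fin hJ.
apply: (@le_lt_trans _ _ (kdiag (RJ J) s)%:E); last by rewrite lte_fin hJ.
apply: nneseries_le_bound => [n|n].
  by rewrite sqnorm2_term lee_fin mulr_ge0// sqr_ge0.
under eq_bigr do rewrite sqnorm2_term.
by rewrite sumEFin lee_fin process_tail_le.
Qed.

Lemma mercer_unif (C : set (S * S)) : compact C -> forall e : R, 0 < e ->
  \forall J \near \oo, forall x y, C (x, y) ->
    normc (K x y - \sum_(j < J) (a j)%:C * z j x * conjc (z j y)) < e /\
    (\sum_(J <= j <oo) (normc ((a j)%:C * z j x * conjc (z j y)))%:E < e%:E)%E.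
Proof.
move=> cC e e0.
(* The diagonal estimate concerns compact subsets of [S], so [C] is projected on both factors. *)
have c1 : compact (fst @` C).
  by apply: continuous_compact cC; apply: continuous_subspaceT => p; exact: cvg_fst.
have c2 : compact (snd @` C).
  by apply: continuous_compact cC; apply: continuous_subspaceT => p; exact: cvg_snd.
near=> J => x y Cxy.
have k0 t : 0 <= kdiag (RJ J) t by exact: (kdiag_remainder_ge0 hX z_eigen z_orth).
have hx : kdiag (RJ J) x < e.
  suff : forall t, (fst @` C) t -> kdiag (RJ J) t < e by apply; exists (x, y).
  near: J; exact: (kdiag_remainder_unif hX cK z_eigen z_orth a_ge0 kdiag_cvg c1 e0).
have hy : kdiag (RJ J) y < e.
  suff : forall t, (snd @` C) t -> kdiag (RJ J) t < e by apply; exists (x, y).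
  near: J; exact: (kdiag_remainder_unif hX cK z_eigen z_orth a_ge0 kdiag_cvg c2 e0).
split.
  rewrite -(@ltr_pXn2r _ 2) ?nnegrE ?normc_ge0 ?(ltW e0)//.
  apply: le_lt_trans (kernel_remainder_CS hX z_eigen z_orth J x y) _.
  by rewrite expr2; apply: ltr_pM.
apply: (@le_lt_trans _ _ ((kdiag (RJ J) x + kdiag (RJ J) y) / 2)%:E).
  apply: nneseries_le_bound => [n|n]; first by rewrite lee_fin normc_ge0.
  by rewrite sumEFin lee_fin mercer_tail_le.
by rewrite lte_fin; lra.
Unshelve. all: by end_near. Qed.

End expansion.

(** * The eigenvalues obtained by deflation *)

Section mercer_sequence.
Context {R : realType} {d d'} {S : topMeasurableType d} {Omega : measurableType d'}.
Variables (mu : {sigma_finite_measure set S -> \bar R}) (P : probability Omega R).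
Variable X : S -> Omega -> R[i].
Hypothesis hX : L2_process mu P X.
Local Notation V := (Xval hX).
Local Notation K := (fun x y => L2dot P (X x) (X y)).
Local Notation dot := (@dotL2 R d S mu).
Local Notation sq := (sqn dot).
Local Notation dotP := (@dotL2 R d' Omega P).
Let dP := dotL2_semi_inner P.
Let dmu := dotL2_semi_inner mu.

Variables (z : nat -> L2fun mu) (a : nat -> R).
Local Notation RJ J := (mercer_remainder P X z a J).
Hypothesis hseq : forall J,
  [/\ covariance_like mu (RJ J),
      is_top_eigenpair (RJ J) (a J) (z J),
      forall x, kop mu K (z J) x = (a J)%:C * z J x
    & forall j, (j < J)%N -> dot (z J) (z j) = 0].

Lemma seq_eigen j x : kop mu K (z j) x = (a j)%:C * z j x.
Proof. by have [_ _ h _] := hseq j; exact: h. Qed.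

Lemma seq_ge0 j : 0 <= a j.
Proof. by have [_ [h _ _ _ _] _ _] := hseq j. Qed.

Lemma seq_alt j : (a j = 0 /\ z j = 0) \/ (0 < a j /\ sq (z j) = 1).
Proof. by have [_ [_ _ h _ _] _ _] := hseq j. Qed.

Lemma seq_orthonormal : orthonormal_on dot (fun j => a j != 0) z.
Proof.
move=> j k; have [<-|] := eqVneq j k.
  have [[-> ->]|[aj s1]] := seq_alt j; first by rewrite (dot0l dmu) eqxx andbF.
  by rewrite (dotvv dmu) s1 gt_eqF.
rewrite neq_ltn => /orP[jk|kj].
  have [_ _ _ h] := hseq k.
  by rewrite (semi_innerC dmu) h// conjc0.
by have [_ _ _ h] := hseq j; rewrite h.
Qed.

Lemma seq_orth j k : a j != 0 -> a k != 0 -> dot (z j) (z k) = (j == k)%:R.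
Proof. by move=> aj _; rewrite seq_orthonormal aj andbT. Qed.

(** For j < k, [z k] is orthogonal to the vectors removed before step j, hence still an eigenvector
    for a_k of the j-th deflated operator, whose form is at most a_j on unit vectors. *)
Lemma seq_antitone j k : (j <= k)%N -> a k <= a j.
Proof.
rewrite leq_eqVlt => /predU1P[->//|jk].
have [[-> _]|[ak s1]] := seq_alt k; first exact: seq_ge0.
have [_ [_ _ _ h _] _ _] := hseq j.
have := h (z k); rewrite s1 mulr1; apply: le_trans.
have -> : kop mu (RJ j) (z k) = (a k)%:C *: z k.
  apply/funext => x; rewrite (kop_remainder hX) seq_eigen big1 ?subr0// => i _.
  rewrite seq_orthonormal (_ : (k == i :> nat) = false) ?mulr0//.
  by apply/negbTE; rewrite neq_ltn (ltn_trans (ltn_ord i) jk) orbT.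
rewrite -[L2dot _ _ _]/(dot ((a k)%:C *: z k) (z k)) (semi_innerZ dmu) ReRM.
by rewrite -[complex.Re _]/(sq (z k)) s1 mulr1.
Qed.

Lemma seq_trace J : \sum_(j < J) a j <= ktrace mu K.
Proof.
have hK := process_covariance_like hX.
have iK := kdiag_integrable hK.
have ifn : (\int[mu]_x (kdiag K x)%:E)%E \is a fin_num by exact: integrable_fin_num.
rewrite -lee_fin /ktrace fineK// -sumEFin.
have -> : (\sum_(j < J) (a j)%:E = \int[mu]_x \sum_(j < J) (a j * normc (z j x) ^+ 2)%:E)%E.
  have mz j : measurable_fun setT (fun x => (normc (z j x) ^+ 2)%:E).
    by apply/measurable_EFinP/measurable_normc_sqr/L2cmeas.
  rewrite ge0_integral_sum//.
  - apply: eq_bigr => j _; under eq_integral do rewrite EFinM.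
    rewrite ge0_integralZl ?lee_fin ?seq_ge0//; last by move=> x _; rewrite lee_fin sqr_ge0.
    rewrite -[X in (_ * X)%E]/(sqnorm2 mu (z j)) sqnorm2E -EFinM.
    by have [[-> _]|[_ ->]] := seq_alt j; rewrite ?mul0r ?mulr1.
  - move=> j; under eq_fun do rewrite EFinM.
    exact: emeasurable_funM.
  - by move=> j x _; rewrite lee_fin mulr_ge0 ?seq_ge0 ?sqr_ge0.
apply: ge0_le_integral => //.
- by move=> x _; apply: sume_ge0 => j _; rewrite lee_fin mulr_ge0 ?seq_ge0 ?sqr_ge0.
- apply: emeasurable_sum => j.
  apply/measurable_EFinP/measurable_funM; first exact: measurable_cst.
  exact/measurable_normc_sqr/L2cmeas.
- exact: measurable_int iK.
- move=> x _; rewrite sumEFin lee_fin -subr_ge0.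
  have := kdiag_remainder_ge0 hX seq_eigen seq_orth J x.
  by rewrite kdiag_remainderE.
Qed.

(** Monotonicity gives (j + 1) a_j <= a_0 + ... + a_j, and this sum is at most the trace. *)
Lemma seq_cvg0 : a j @[j --> \oo] --> 0.
Proof.
apply/cvgrPdist_lt => e e0.
have t0 := ktrace_ge0 (process_covariance_like hX).
pose N := Num.bound (ktrace mu K / e).
near=> j; rewrite sub0r normrN ger0_norm ?seq_ge0//.
have jN : (N <= j)%N by near: j; exists N.
have h : a j * j.+1%:R <= ktrace mu K.
  apply: le_trans (seq_trace j.+1).
  rewrite mulr_natr -[X in _ *+ X]card_ord -sumr_const.
  by apply: ler_sum => i _; apply: seq_antitone; rewrite -ltnS.
have hN : ktrace mu K / e < N%:R by apply: archi_boundP; rewrite divr_ge0// ltW.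
rewrite ltr_pdivrMr// in hN.
rewrite -(@ltr_pM2r _ j.+1%:R) ?ltr0n//.
apply: le_lt_trans h _; apply: lt_le_trans hN _; rewrite mulrC ler_wpM2l ?(ltW e0)//.
by rewrite ler_nat; exact: leq_trans jN _.
Unshelve. all: by end_near. Qed.

Hypothesis cK : continuous ((fun p : S * S => K p.1 p.2) : S * S -> R[i]^o).
Hypothesis hmu : strictly_positive_measure mu.

(* If the diagonal stayed above [e] at [x], then [|RJ J y x|] would stay above
   [e / 2] on a neighbourhood of [x], contradicting
   [\int |RJ J y x|^2 dy <= a_J K(x, x)]. *)
Lemma seq_kdiag_cvg x : kdiag (RJ J) x @[J --> \oo] --> 0.
Proof.
have k0 J t : 0 <= kdiag (RJ J) t by exact: (kdiag_remainder_ge0 hX seq_eigen seq_orth).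
have kle J L t : (J <= L)%N -> kdiag (RJ L) t <= kdiag (RJ J) t.
  exact: (kdiag_remainder_le P X z seq_ge0).
apply/cvgrPdist_lt => e e0; apply: contrapT => hn.
have ke J : e <= kdiag (RJ J) x.
  rewrite leNgt; apply/negP => hJ; apply: hn; exists J => // L /= JL.
  rewrite sub0r normrN ger0_norm//; exact: le_lt_trans (kle _ _ _ JL) hJ.
have kK J : kdiag (RJ J) x <= kdiag K x.
  by have := kle 0%N J x (leq0n J); rewrite [X in _ <= X]kdiag_remainderE big_ord0 subr0.
have [mopen _ popen _] := hmu.
have Kx0 : 0 <= kdiag K x by exact: le_trans (k0 0%N x) (kK 0%N).
(* With this radius, Cauchy-Schwarz gives |K_J(x, x) - K_J(y, x)|^2 <= ||X_x - X_y||^2 K(x, x) < (e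
   / 2)^2 for all J; the 1 guards against K(x, x) = 0. *)
have ep : 0 < (e / 2) ^+ 2 / (kdiag K x + 1).
  by rewrite divr_gt0 ?exprn_gt0 ?divr_gt0// ltr_wpDl.
have : nbhs x [set y | sqn dotP (V x - V y) < (e / 2) ^+ 2 / (kdiag K x + 1)].
  exact: (increment_cvg hX cK x ep).
rewrite nbhsE => -[U [oU Ux] hU].
have mU : measurable U by exact: mopen.
have pU : (0 < mu U)%E by apply: popen => //; exists x.
have lb J y : U y -> (e / 2) ^+ 2 <= normc (RJ J y x) ^+ 2.
  move=> /hU /=; rewrite ltr_pdivlMr; last by rewrite ltr_wpDl.
  move=> hy.
  have s0 := sqn_ge0 dP (V x - V y).
  have d1 : normc (RJ J x x - RJ J y x) ^+ 2 < (e / 2) ^+ 2.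
    apply: le_lt_trans hy.
    rewrite -!(dot_remainder hX (fun j _ => seq_eigen j) (fun j k _ _ => @seq_orth j k)).
    rewrite -(dotBl dP); apply: le_trans (Cauchy_Schwarz dP _ _) _.
    rewrite (sqn_remainderE hX seq_eigen seq_orth).
    apply: ler_pM => //; first exact: (sqn_ge0 dP).
      exact: (remainder_increment_le hX seq_eigen seq_orth seq_ge0).
    by apply: le_trans (kK J) _; rewrite lerDl.
  rewrite ltr_pXn2r ?nnegrE ?normc_ge0 ?divr_ge0 ?(ltW e0)// in d1.
  rewrite ler_pXn2r ?nnegrE ?normc_ge0 ?divr_ge0 ?(ltW e0)//.
  have := ke J; have := Re_le_normc (RJ J x x).
  have := normcD_le (RJ J x x - RJ J y x) (RJ J y x); rewrite subrK.
  rewrite -/(kdiag (RJ J) x); lra.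
have ub J : (((e / 2) ^+ 2)%:E * mu U <= (a J * kdiag K x)%:E)%E.
  have [cJ [_ _ _ _ h5] _ _] := hseq J.
  apply: (@le_trans _ _ (a J * kdiag (RJ J) x)%:E); last first.
    by rewrite lee_fin ler_wpM2l// seq_ge0.
  apply: le_trans (h5 x).
  have -> : (((e / 2) ^+ 2)%:E * mu U = \int[mu]_y (((e / 2) ^+ 2)%:E * (\1_U y)%:E))%E.
    rewrite ge0_integralZl ?lee_fin ?sqr_ge0//; first by rewrite integral_indic ?setIT.
    by apply/measurable_EFinP; exact: measurable_indic.
  apply: ge0_le_integral => //.
  - by move=> y _; rewrite mule_ge0// ?lee_fin ?sqr_ge0.
  - by apply: emeasurable_funM => //; apply/measurable_EFinP; exact: measurable_indic.
  - exact/measurable_EFinP/measurable_normc_sqr/(section_L2 cJ x).1.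
  - move=> y _; rewrite -EFinM lee_fin indicE.
    by have [/set_mem/lb|_] := boolP (y \in U); rewrite ?mulr1 ?mulr0 ?sqr_ge0.
have e2 : 0 < (e / 2) ^+ 2 by rewrite exprn_gt0 ?divr_gt0.
have mUfin : mu U \is a fin_num.
  rewrite ge0_fin_numE//; have := ub 0%N.
  case: (mu U) pU => [r| |] //= _; first by rewrite ltry.
  by rewrite gt0_muley ?lte_fin// leye_eq.
pose m := fine (mu U).
have m0 : 0 < m by rewrite fine_gt0// pU ltey_eq mUfin.
have ub' J : (e / 2) ^+ 2 * m <= a J * kdiag K x.
  by rewrite -lee_fin EFinM /m fineK// ub.
have : a J * kdiag K x @[J --> \oo] --> 0.
  by rewrite -[X in _ --> X](mul0r (kdiag K x)); apply: cvgM; [exact: seq_cvg0|exact: cvg_cst].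
move=> /cvgrPdist_lt /(_ ((e / 2) ^+ 2 * m)); rewrite mulr_gt0// => /(_ isT) [n _ hnn].
have := hnn n (leqnn n); rewrite /= sub0r normrN ger0_norm ?mulr_ge0 ?seq_ge0//.
by rewrite ltNge ub'.
Qed.

End mercer_sequence.

(** * Completion to a basis *)

Section mercer_basis.
Context {R : realType} {d d'} {S : topMeasurableType d} {Omega : measurableType d'}.
Variables (mu : {sigma_finite_measure set S -> \bar R}) (P : probability Omega R).
Variable X : S -> Omega -> R[i].
Hypothesis hX : L2_process mu P X.
Local Notation K := (fun x y => L2dot P (X x) (X y)).
Local Notation dot := (@dotL2 R d S mu).
Local Notation sq := (sqn dot).
Let dmu := dotL2_semi_inner mu.
Let hK := process_covariance_like hX.

Section residuals.
Variables (z : nat -> L2fun mu) (a : nat -> R).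
Local Notation RJ J := (mercer_remainder P X z a J).
Hypothesis hseq : forall J,
  [/\ covariance_like mu (RJ J),
      is_top_eigenpair (RJ J) (a J) (z J),
      forall x, kop mu K (z J) x = (a J)%:C * z J x
    & forall j, (j < J)%N -> dot (z J) (z j) = 0].

Local Notation residual f J := (f - psum z (fun j => dot f (z j)) J).

(** By completeness the residuals converge; the limit is the component of [f] orthogonal to all
    eigenfunctions. *)
Lemma residual_limit (f : L2fun mu) : exists2 r : L2fun mu,
  (forall n, dot r (z n) = 0) & sq (residual f J - r) @[J --> \oo] --> 0.
Proof.
have oz := seq_orthonormal hseq.
have [r hr] := L2_complete (residual_cauchy dmu f oz).
exists r => // n; apply/eqP/negPn/negP => rn0.
have e0 : 0 < normc (dot r (z n)) ^+ 2.
  rewrite exprn_gt0// lt_def normc_ge0 andbT.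
  by apply: contra_neq rn0; exact: ComplexField.Normc.eq0_normc.
have [N hN] := cvg0_eventually (fun J => sqn_ge0 dmu _) hr e0.
have := hN _ (leq_maxl N n.+1); apply/negP; rewrite -leNgt.
have -> : dot r (z n) = - dot (residual f (maxn N n.+1) - r) (z n).
  by rewrite (dotBl dmu) (dot_residual dmu oz) ?leq_maxr// sub0r opprK.
rewrite normcN; apply: le_trans (Cauchy_Schwarz dmu _ _) _.
rewrite ler_piMr ?(sqn_ge0 dmu)//.
by have [[_ ->]|[_ ->]] := seq_alt hseq n; rewrite ?(sqn0 dmu).
Qed.

(** Deflation does not change T r, so |T r(x)|^2 <= ||r||^2 ||K_J(., x)||^2 <= ||r||^2 a_J K(x, x)
    for every J, and a_J tends to 0. *)
Lemma kop_orthogonal (r : L2fun mu) x : (forall n, dot r (z n) = 0) -> kop mu K r x = 0.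
Proof.
move=> rz; apply/eqP/negPn/negP => k0.
have e0 : 0 < normc (kop mu K r x) ^+ 2.
  rewrite exprn_gt0// lt_def normc_ge0 andbT.
  by apply: contra_neq k0; exact: ComplexField.Normc.eq0_normc.
have hb J : normc (kop mu K r x) ^+ 2 <= (sq r * kdiag K x) * a J.
  have [cJ [aJ _ _ _ h5] _ _] := hseq J.
  have -> : kop mu K r x = kop mu (RJ J) r x.
    by rewrite (kop_remainder hX) big1 ?subr0// => j _; rewrite rz mulr0.
  rewrite -[kop mu (RJ J) r x]/(Kop cJ r x) KopE.
  apply: le_trans (Cauchy_Schwarz dmu _ _) _; rewrite -mulrA ler_wpM2l ?(sqn_ge0 dmu)//.
  have := h5 x; rewrite -[sqnorm2 _ _]/(sqnorm2 mu (Ksec cJ x)) sqnorm2E lee_fin => /le_trans.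
  apply; rewrite mulrC ler_wpM2r//.
  have := kdiag_remainder_le P X z (seq_ge0 hseq) x (leq0n J).
  by rewrite [X in _ <= X]kdiag_remainderE big_ord0 subr0.
have : sq r * kdiag K x * a J @[J --> \oo] --> 0.
  by rewrite -[X in _ --> X](mulr0 (sq r * kdiag K x)); apply: cvgM; [exact: cvg_cst|exact: (seq_cvg0 hX hseq)].
have b0 J : 0 <= sq r * kdiag K x * a J.
  by rewrite !mulr_ge0 ?(sqn_ge0 dmu) ?(kdiag_ge0 hK) ?(seq_ge0 hseq).
move=> /(cvg0_eventually b0) /(_ _ e0) [N hN].
by have := hN N (leqnn N); rewrite ltNge hb.
Qed.

(* Subtracting from each [e i] its projection on the span of [z] leaves a vector
   of the null space of the operator; [psi] is obtained from these vectors by the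
   Gram-Schmidt process. *)
Lemma mercer_complement (e : nat -> L2fun mu) : exists nz (psi : nat -> L2fun mu),
  [/\ orthonormal_on dot nz psi,
      forall k n, dot (psi k) (z n) = 0,
      forall k x, kop mu K (psi k) x = 0
    & forall i w, (forall n, closed_span dot w (z n)) -> (forall k, closed_span dot w (psi k)) ->
        closed_span dot w (e i)].
Proof.
have /choice [r hr] i : exists r : L2fun mu, (forall n, dot r (z n) = 0) /\
    sq (residual (e i) J - r) @[J --> \oo] --> 0.
  by have [r h1 h2] := residual_limit (e i); exists r.
have [||nz [psi [opsi Qpsi rpsi]]] := @Gram_Schmidt _ _ _ dmu
    (fun u => forall n, dot u (z n) = 0) r.
- by move=> i; exact: (hr i).1.
- by move=> k u v hu hv n; rewrite (semi_innerD dmu) (semi_innerZ dmu) hu hv mulr0 addr0.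
exists nz, psi; split=> // [k x|i w wz wpsi]; first exact: kop_orthogonal.
have wr : closed_span dot w (r i).
  have [J [c hc]] := rpsi i.
  have -> : r i = (r i - psum psi c J) + psum psi c J by rewrite subrK.
  apply: (closed_spanD dmu); first exact: closed_span_null.
  exact: (closed_span_trans dmu wpsi (closed_span_psum dmu psi c J)).
apply: (closed_span_limit dmu) => eps eps0.
have [N hN] := cvg0_eventually (fun J => sqn_ge0 dmu _) (hr i).2 eps0.
exists (psum z (fun j => dot (e i) (z j)) N + r i); last by rewrite opprD addrA hN.
exact: (closed_spanD dmu (closed_span_trans dmu wz (closed_span_psum dmu z _ N)) wr).
Qed.

End residuals.

Hypothesis cK : continuous ((fun p : S * S => K p.1 p.2) : S * S -> R[i]^o).
Hypothesis hmu : strictly_positive_measure mu.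

Record mercer_system (z : nat -> L2fun mu) (a : nat -> R) : Prop := {
  system_eigen : forall j x, kop mu K (z j) x = (a j)%:C * z j x;
  system_orth : forall j k, a j != 0 -> a k != 0 -> dot (z j) (z k) = (j == k)%:R;
  system_ge0 : forall j, 0 <= a j;
  system_antitone : forall j k, (j <= k)%N -> a j != 0 -> a k <= a j;
  system_cvg0 : a j @[j --> \oo] --> 0;
  system_kdiag : forall x, kdiag (mercer_remainder P X z a J) x @[J --> \oo] --> 0 }.

Lemma mercer_system_basis : exists z a, mercer_system z a /\
  ((exists e : nat -> S -> R[i], orthonormal_basis mu e) ->
    orthonormal_basis mu (fun j => z j : S -> R[i])).
Proof.
have [z [a hseq]] := eigen_sequence hX.
have kc := seq_kdiag_cvg hX hseq cK hmu.
(* Without a basis indexed by nat, the deflation sequence itself serves, its zero vectors having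
   eigenvalue 0. *)
have [[e [eL2 e_on e_tot]]|noe] := pselect (exists e : nat -> S -> R[i], orthonormal_basis mu e);
  last first.
  exists z, a; split=> //; split=> //.
  - exact: (seq_eigen hseq).
  - exact: (seq_orth hseq).
  - exact: (seq_ge0 hseq).
  - by move=> j k jk _; exact: (seq_antitone hX hseq).
  - exact: (seq_cvg0 hX hseq).
pose E i := toL2 (eL2 i).
have [nz' [psi [opsi psiz kpsi he]]] := mercer_complement hseq E.
have oz := seq_orthonormal hseq.
(* Even positions hold the eigenfunctions, odd ones the null space; alternation leaves room for
   infinite families of both kinds. *)
pose w k := if odd k then psi k./2 else z k./2.
pose b k := if odd k then 0 else a k./2.
pose nz k := if odd k then nz' k./2 else a k./2 != 0.
have ow : orthonormal_on dot nz w.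
  move=> j k; rewrite /w /nz.
  have jk : odd j = odd k -> (j./2 == k./2) = (j == k).
    move=> o; apply/eqP/eqP => [h|->//].
    by rewrite -(odd_double_half j) -(odd_double_half k) o h.
  case: ifPn => oj; case: ifPn => ok.
  - by rewrite opsi jk// oj ok.
  - by rewrite psiz (_ : (j == k) = false)//; apply: contraNF ok => /eqP <-.
  - rewrite (semi_innerC dmu) psiz conjc0 (_ : (j == k) = false)//.
    by apply: contraNF oj => /eqP ->.
  - by rewrite oz jk// (negPf oj) (negPf ok).
have w_eigen k x : kop mu K (w k) x = (b k)%:C * w k x.
  by rewrite /w /b; case: ifP => _; [rewrite kpsi mul0r|exact: (seq_eigen hseq)].
have approx_E v : (forall k, closed_span dot v (w k)) -> forall i, closed_span dot v (E i).
  move=> vw i; apply: he => n.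
    by have := vw n.*2; rewrite /w odd_double doubleK.
  by have := vw n.*2.+1; rewrite /w /= odd_double /= uphalf_double.
have oE : orthonormal_on dot xpredT E by move=> j k; rewrite andbT; exact: e_on.
(* Finitely many nonnull vectors could not approximate the infinite orthonormal family [E]. Hence
   deleting the null entries of [w] still leaves a sequence indexed by nat. *)
have nz_inf N : exists k, (N <= k)%N && nz k.
  apply: contrapT => hN.
  apply: (@finite_not_total _ _ _ dmu nz w E N) => //.
    by move=> k Nk; apply/negP => nk; apply: hN; exists k; rewrite Nk nk.
  by move=> i; apply: (approx_E w (closed_span_gen dmu w)); rewrite invr_gt0.
pose s := enumerate nz_inf.
have s_inj : injective s by exact: enumerate_inj.
pose z' j := w (s j); pose a' j := b (s j).
have oz' j k : dot (z' j) (z' k) = (j == k)%:R.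
  by rewrite /z' ow (inj_eq s_inj) enumerate_p andbT.
have b_ge0 k : 0 <= b k by rewrite /b; case: ifP => // _; exact: (seq_ge0 hseq).
have b0 k : ~~ nz k -> b k = 0.
  by rewrite /nz /b; case: ifP => // _; rewrite negbK => /eqP.
exists z', a'; split.
  split=> [j x|j k _ _|j|j k jk||x].
  - exact: w_eigen.
  - exact: oz'.
  - exact: b_ge0.
  - rewrite /a' /b; case: ifP => [_|oj aj0]; first by rewrite eqxx.
    case: ifP => [_|ok]; first exact: (seq_ge0 hseq).
    apply: (seq_antitone hX hseq); apply: half_leq.
    move: jk; rewrite leq_eqVlt => /predU1P[->//|jk].
    by apply/ltnW; exact: enumerate_lt.
  - apply/cvgrPdist_lt => eps eps0.
    have /cvgrPdist_lt /(_ _ eps0) [N _ hN] := seq_cvg0 hX hseq.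
    exists N.*2 => // j /= Nj; rewrite /a' /b; case: ifP => _; first by rewrite subrr normr0.
    apply: hN => /=; rewrite -(doubleK N); apply: half_leq.
    exact: leq_trans Nj (enumerate_ge _ _).
  (* Odd positions and deleted vectors have eigenvalue 0, so a partial sum for the new system is one
     for the old system, of length [uphalf (s J)]. *)
  - have -> : (fun J => kdiag (mercer_remainder P X z' a' J) x) =
        (fun J => kdiag (mercer_remainder P X z a (uphalf (s J))) x).
      apply/funext => J; rewrite !kdiag_remainderE; congr (_ - _).
      rewrite -(@enumerate_sum _ nz_inf _ (fun k => b k * normc (w k x) ^+ 2)).
        rewrite (@interleave_sum _ (fun k => b k * normc (w k x) ^+ 2)).
          by apply: eq_bigr => j _; rewrite /b /w odd_double doubleK.
        by move=> k ok; rewrite /b ok mul0r.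
      by move=> k /b0 ->; rewrite mul0r.
    apply/cvgrPdist_lt => eps eps0.
    have /cvgrPdist_lt /(_ _ eps0) [N _ hN] := kc x.
    exists N.*2 => // J /= NJ; apply: hN => /=.
    rewrite -(half_double N) uphalf_half; apply: leq_trans (leq_addl _ _).
    by apply: half_leq; exact: leq_trans NJ (enumerate_ge _ _).
move=> _; split=> [j|j k|f lf]; [exact: L2valP|exact: oz'|].
have oz'' : orthonormal_on dot xpredT z' by move=> j k; rewrite andbT oz'.
have z'w k : closed_span dot z' (w k).
  have [nk|nk] := boolP (nz k).
    have [j sj] := enumerate_surj nz_inf nk.
    by rewrite -sj; exact: (closed_span_gen dmu z').
  exact: (closed_span_null _ (orthonormal_on_null ow nk)).
(* [z'] approximates each vector of the given basis, whose finite combinations approximate every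
   function. *)
have tz' : complete_family dot z'.
  move=> g; apply: (closed_span_trans dmu (approx_E _ z'w)) => eps eps0.
  have := e_tot g (L2valP g).
  under eq_cvg => J.
    rewrite (_ : sqnorm2 mu _ = (sq (g - psum E (fun j => dot g (E j)) J))%:E); last first.
      rewrite -sqnorm2E; congr sqnorm2; apply/funext => x.
      by rewrite L2valB L2val_sum.
    over.
  move=> /fine_cvg /(cvg0_eventually (fun J => sqn_ge0 dmu _)) /(_ _ eps0) [N hN].
  by exists N, (fun j => dot g (E j)); exact: hN.
pose F := toL2 lf.
have h := total_cvg dmu oz'' F tz'.
under eq_cvg => J.
  rewrite (_ : sqnorm2 mu _ = (sq (F - psum z' (fun j => dot F (z' j)) J))%:E); last first.
    rewrite -sqnorm2E; congr sqnorm2; apply/funext => x.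
    by rewrite L2valB L2val_sum.
  over.
by apply: cvg_EFin; [exact: nearW|exact: h].
Qed.

End mercer_basis.

Theorem theorem7p1 (R : realType) (d d' : measure_display)
  (S : topMeasurableType d) (mu : {sigma_finite_measure set S -> \bar R})
  (Omega : measurableType d') (P : probability Omega R)
  (X : S -> Omega -> R[i])
  (hmu : strictly_positive_measure mu)
  (hP : measure_is_complete P)
  (hXmeas : cmeasurable (fun p : Omega * S => X p.2 p.1))
  (hX2 : forall s, L2 P (X s))
  (hX0 : forall s, cexpectation P (X s) = 0)
  (hXcont : continuous
     ((fun p : S * S => covariance_function P X p.1 p.2) : S * S -> R[i]^o))
  (hXint : (\int[mu]_s sqnorm2 P (X s) < +oo)%E) :
  exists (z : nat -> S -> R[i]) (a : nat -> R),
    [/\ mercer_expansion mu (covariance_kernel P X) z a,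
        (forall j,
           [/\ {ae P, forall w, cintegrable mu (fun s => X s w * (z j s)^*)},
               L2 P (KL_coef X mu z j),
               cexpectation P (KL_coef X mu z j) = 0
             & cvariance P (KL_coef X mu z j) = (a j)%:E]) /\
        (forall j k,
           cexpectation P (fun w => KL_coef X mu z j w * (KL_coef X mu z k w)^*)
             = (j == k)%:R * (a j)%:C),
        (\int[P]_w sqnorm2 mu (fun s => KL_remainder X mu z J s w))%E
          @[J --> \oo] --> 0%E,
        forall s, sqnorm2 P (KL_remainder X mu z J s) @[J --> \oo] --> 0%E
      & forall C : set S, compact C -> forall e : R, 0 < e ->
          \forall J \near \oo, forall s, C s ->
            (sqnorm2 P (KL_remainder X mu z J s) < e%:E)%E /\
            (\sum_(J <= j <oo) sqnorm2 P (fun w => KL_coef X mu z j w * z j s)%R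
               < e%:E)%E].
Proof.
have hX : L2_process mu P X by split.
have cK : continuous
    ((fun p : S * S => L2dot P (X p.1) (X p.2)) : S * S -> R[i]^o).
  (* Centring identifies the covariance function, assumed continuous, with the kernel. *)
  have E : (fun p : S * S => L2dot P (X p.1) (X p.2)) =
      (fun p : S * S => covariance_function P X p.1 p.2).
    apply/funext => p; rewrite /covariance_function !hX0; congr cintegral.
    by apply/funext => w; rewrite !subr0.
  by rewrite E; exact: hXcont.
have [z [a [[z_eigen z_orth a_ge0 a_anti a_cvg0 kd] basis]]] :=
  mercer_system_basis hX cK hmu.
exists (fun j => z j : S -> R[i]), a; split.
- split.
  + exact: cK.
  + split; [by move=> j; exact: L2valP|exact: z_orth|exact: basis|].
    by move=> j aj0; exact: (eigenfunction_continuous hX cK z_eigen aj0).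
  + by split.
  + exact: z_eigen.
  + exact: (mercer_unif hX z_eigen z_orth a_ge0 kd cK).
- split=> [j|j k]; last exact: (coef_orthogonal hX z_eigen z_orth).
  have c0 := cexpectation_coef hX (z j) hX0.
  split.
  + exact: (path_cintegrable hX (L2valP (z j))).
  + exact: (coef_L2 hX (L2valP (z j))).
  + exact: c0.
  + rewrite /cvariance -(sqn_coef hX z_eigen z_orth) -sqnorm2E.
    by congr sqnorm2; apply/funext => w; rewrite [cexpectation _ _]c0 subr0.
- exact: (integral_remainder_cvg hX z_eigen z_orth a_ge0 kd).
- exact: (remainder_cvg hX z_eigen z_orth kd).
- exact: (remainder_unif hX z_eigen z_orth a_ge0 kd cK).
Qed.
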